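(* Let $\mathcal{X}:y^n=f(x)$ be a superelliptic curve of genus $g\geq 2$ over a field $k$, with $f$ having distinct roots, $\deg f=d>n$, $\gcd(n,d)=1$. Let $D_1,D_2\in\operatorname{Jac}_k(\mathcal{X})$ be written in reduced form as $D_1=\sum_{i=1}^gP_i-g\infty$ and $D_2=\sum_{i=g+1}^{2g}P_i-g\infty$, where $P_1=(x_1,y_1),\dots,P_{2g}=(x_{2g},y_{2g})\in\mathcal{X}$ are all distinct. Let $\varphi_1,\dots,\varphi_{2g+1}$ be the first $2g+1$ nonzero entries of $B_{n,d}$ (i.e. the first $2g+1$ monomials $x^iy^j$ ordered by pole order at $\infty$), and let $\mathcal Y$ be the curve $\det A_{(\varphi_1,\dots,\varphi_{2g+1})}(P_1,\dots,P_{2g})=0$. Then $\mathcal Y$ intersects $\mathcal{X}$ in precisely $g$ points $P_{2g+1},\dots,P_{3g}$ in addition to $P_1,\dots,P_{2g}$. Moreover, $D_1+D_2=-\left(\sum_{i=2g+1}^{3g}P_i-g\infty\right)$ in $\operatorname{Jac}_k(\mathcal{X})$.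
   Context: $\infty$ denotes the unique point at infinity of $\mathcal{X}$, a branch point of $(x,y)\mapsto x$. The pole order at $\infty$ of $x^iy^j$ is $ni+dj$. $B_{n,d}$ is the $n\times(d+1)$ matrix whose $(j,i)$ entry ($0\le j\le n-1$, $0\le i\le d$) is $x^iy^j$ if that monomial is among the first $2g+1$ monomials (with $0\leq j\leq n-1$) ordered by pole order at $\infty$, and $0$ otherwise. $A_{(\varphi_1,\dots,\varphi_{2g+1})}(P_1,\dots,P_{2g})$ is the $(2g+1)\times(2g+1)$ matrix with first row $(\varphi_1(x,y),\dots,\varphi_{2g+1}(x,y))$ and $(i+1)$-st row $(\varphi_1(x_i,y_i),\dots,\varphi_{2g+1}(x_i,y_i))$.
   Formalization: Assumes det A is not identically zero (it vanishes e.g. for y^2=quintic with D_2 the conjugate of D_1) and that n is invertible in k; the g further points are counted with multiplicity on the complete curve, so may repeat, equal earlier P_i, or be ∞. *)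

(* Defs.v *)
From HB Require Import structures.
From mathcomp Require Import all_boot all_order all_algebra.
From mathcomp.multinomials Require Import freeg.

Set Implicit Arguments.
Unset Strict Implicit.
Unset Printing Implicit Defensive.

Import GRing.Theory Num.Theory.
Local Open Scope ring_scope.

(* Bivariate polynomials are elements of {poly {poly R}}: the outer
   indeterminate is y, the inner one is x. *)

Section Bivariate.
Variable R : comNzRingType.

Definition xvar : {poly {poly R}} := 'X%:P.
Definition yvar : {poly {poly R}} := 'X.
Definition cst (c : R) : {poly {poly R}} := c%:P%:P.
Definition eval2 (h : {poly {poly R}}) (a b : R) : R := h.[b%:P].[a].

(* A pair (i, j) encodes the monomial x^i y^j. *)
Definition monom (e : nat * nat) : {poly {poly R}} :=
  xvar ^+ e.1 * yvar ^+ e.2.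

End Bivariate.

(* The curve y^n = f(x) over an algebraically closed field K.  It is used for
   1 < n < deg f, n coprime to deg f, n invertible in K and f with distinct
   roots: the affine curve is then smooth, and its smooth completion has exactly
   one more point. *)
Section Curve.
Variables (K : closedFieldType) (n : nat) (f : {poly K}).

Definition distinct_roots : Prop :=
  exists2 rs : seq K, uniq rs & f = lead_coef f *: \prod_(r <- rs) ('X - r%:P).

Definition curve_eq : {poly {poly K}} := yvar K ^+ n - f%:P.

Definition affine_pt : Type := {p : K * K | p.2 ^+ n == f.[p.1]}.

Definition xcoord (P : affine_pt) : K := (val P).1.
Definition ycoord (P : affine_pt) : K := (val P).2.

(* The complete curve; None is the point at infinity. *)
Definition pt : Type := option affine_pt.

Definition infty : pt := None.

Definition divisor : Type := {freeg pt / int}.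

Definition divpt (P : pt) : divisor := << P >>.
Definition mult (D : divisor) (P : pt) : int := coeff P D.

(* h restricts to an element of m_P^m, where m_P is the maximal ideal of the
   local ring of the curve at P: as M_P = (x - a, y - b) is a maximal ideal of
   K[x, y], M_P^m + (curve_eq) needs no further localization. *)
Definition vanishes (P : affine_pt) (m : nat) (h : {poly {poly K}}) : Prop :=
  exists (c : 'I_m.+1 -> {poly {poly K}}) (q : {poly {poly K}}),
    h = \sum_(i < m.+1) c i * (xvar K - cst (xcoord P)) ^+ i
                            * (yvar K - cst (ycoord P)) ^+ (m - i)
        + q * curve_eq.

(* The normalized valuation at P of the restriction of h to the curve, which is
   also the intersection multiplicity at P of the curve with h = 0; no m
   qualifies when h is zero on the curve. *)
Definition has_order (P : affine_pt) (h : {poly {poly K}}) (m : nat) : Prop :=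
  vanishes P m h /\ ~ vanishes P m.+1 h.

Definition monom_pole (e : nat * nat) : nat := n * e.1 + (size f).-1 * e.2.

(* Pole order at infinity of a function given by a polynomial nonzero on the
   curve: modulo y^n = f(x) it is a combination of monomials x^i y^j with j < n,
   whose pole orders are pairwise distinct since n and deg f are coprime. *)
Definition pole_order (h : {poly {poly K}}) : nat :=
  let r := Pdiv.Ring.rmodp h curve_eq in
  \max_(j < size r | (r`_j != 0)%R) monom_pole ((size (r`_j)%R).-1, val j).

Definition is_div (h : {poly {poly K}}) (D : divisor) : Prop :=
  (forall P : affine_pt,
      exists2 m : nat, has_order P h m & mult D (Some P) = m%:Z)
  /\ mult D infty = - (pole_order h)%:Z.

(* Every nonzero rational function is a quotient h / u of two polynomials that
   are nonzero on the curve. *)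
Definition principal (D : divisor) : Prop :=
  exists (h u : {poly {poly K}}) (Dh Du : divisor),
    [/\ is_div h Dh, is_div u Du & D = Dh - Du].

Definition lin_equiv (D D' : divisor) : Prop := principal (D - D').

Definition effective (D : divisor) : Prop := forall P : pt, 0 <= mult D P.

(* There are r linearly independent functions h_i / u in the Riemann-Roch space
   L(D); no generality is lost by taking a common denominator. *)
Definition RR_dim_ge (D : divisor) (r : nat) : Prop :=
  exists (u : {poly {poly K}}) (Du : divisor) (h : 'I_r -> {poly {poly K}}),
    [/\ is_div u Du,
        forall (c : 'I_r -> K) (q : {poly {poly K}}),
          \sum_i cst (c i) * h i = q * curve_eq -> forall i, c i = 0
      & forall i, exists2 Dh, is_div (h i) Dh & effective (Dh - Du + D)].

Definition RR_dim (D : divisor) (l : nat) : Prop :=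
  RR_dim_ge D l /\ ~ RR_dim_ge D l.+1.

(* The genus of the function field: the maximum of deg D + 1 - l(D) over all
   divisors D. *)
Definition is_genus (g : nat) : Prop :=
  (forall (D : divisor) (l : nat), RR_dim D l -> deg D + 1 - l%:Z <= g%:Z)
  /\ (exists (D : divisor) (l : nat), RR_dim D l /\ deg D + 1 - l%:Z = g%:Z).

(* D = P_1 + ... + P_m - m oo is in reduced form: the P_i are affine, and m is
   minimal among the E' - m' oo, E' effective, that are equivalent to D. *)
Definition reduced_form (D : divisor) (m : nat) : Prop :=
  (exists P : 'I_m -> affine_pt,
      D = \sum_i divpt (Some (P i)) - divpt infty *+ m)
  /\ (forall (E' : divisor) (m' : nat),
        effective E' -> deg E' = m'%:Z ->
        lin_equiv D (E' - divpt infty *+ m') -> (m <= m')%N).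

(* e enumerates, by increasing pole order at infinity, the first N monomials
   x^i y^j with i >= 0 and 0 <= j < n. *)
Definition first_monoms (N : nat) (e : 'I_N -> nat * nat) : Prop :=
  [/\ forall s, ((e s).2 < n)%N,
      forall s t : 'I_N, (s < t)%N -> (monom_pole (e s) < monom_pole (e t))%N
    & forall m : nat * nat, (m.2 < n)%N ->
        (exists s, e s = m)
        \/ (forall s, (monom_pole (e s) < monom_pole m)%N)].

Definition interp_mx (N : nat) (e : 'I_N.+1 -> nat * nat)
    (P : 'I_N -> affine_pt) : 'M[{poly {poly K}}]_N.+1 :=
  \matrix_(r, s)
    if unlift ord0 r is Some i
    then cst (eval2 (monom K (e s)) (xcoord (P i)) (ycoord (P i)))
    else monom K (e s).

(* Z is the intersection, counted with multiplicities, of the complete curve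
   with h = 0, where h is seen as a section of O(N oo): at an affine point the
   multiplicity is the order of h, at infinity it is N minus the pole order
   of h. *)
Definition is_intersection (N : nat) (h : {poly {poly K}}) (Z : divisor) :=
  is_div h (Z - divpt infty *+ N).

End Curve.

(* Descent to a subfield k: here iota : k -> K, and f has coefficients in k. *)
Section Rationality.
Variables (k : fieldType) (K : closedFieldType) (iota : {rmorphism k -> K}).
Variables (n : nat) (f : {poly k}).

Definition fK : {poly K} := map_poly iota f.
Definition poly2K (h : {poly {poly k}}) : {poly {poly K}} :=
  map_poly (map_poly iota) h.

(* D has local equations u1 / u2 over k, on neighbourhoods w <> 0 defined over k.
   No condition is needed at infinity, which is a k-rational point. *)
Definition rational_div (D : divisor n fK) : Prop :=
  forall P : affine_pt n fK,
  exists (w u1 u2 : {poly {poly k}}) (D1 D2 : divisor n fK),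
    [/\ eval2 (poly2K w) (xcoord P) (ycoord P) != 0,
        is_div (poly2K u1) D1, is_div (poly2K u2) D2
      & forall Q : affine_pt n fK,
          eval2 (poly2K w) (xcoord Q) (ycoord Q) != 0 ->
          mult D (Some Q) = mult (D1 - D2) (Some Q)].

(* Jac_k is the subgroup of k-rational classes of the group of divisor classes
   of degree 0 over K.  Since the curve has a k-rational point, these are the
   classes of the k-rational divisors. *)
Definition in_Jac (D : divisor n fK) : Prop :=
  deg D = 0 /\ exists2 D', rational_div D' & lin_equiv D D'.

Definition eq_Jac (D D' : divisor n fK) : Prop :=
  [/\ in_Jac D, in_Jac D' & lin_equiv D D'].

End Rationality.

(* Main.v *)
(* A function h on the curve that is polynomial in x and y has, at an affine
   point P, a valuation that is read off the filtration by the ideals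
   m_P^m + (curve): one of x - a, y - b is a uniformizer t, and t^m does not lie
   in m_P^(m+1) + (curve) because, by Hensel's lemma, the curve has at P a
   parametrization by polynomials in t up to any order.  At infinity
   the substitution x = T^n, y = c T^d with c^n = lead_coef f computes the pole
   order up to terms of lower degree.  Both are therefore additive.  The norm
   \prod_i h(x, z^i y), with z a primitive n-th root of unity, is a polynomial in
   x, and lines x = a have explicit divisors of degree 0; hence every div h has
   degree 0, and a function without affine poles is a polynomial.  So
   L(3g oo) is spanned by monomials, and the definition of the genus yields at
   least 2g+1 monomials of pole order at most 3g.  The interpolation determinant
   thus has at most 3g poles, all at infinity, and it vanishes at the 2g points
   P_i: the remaining g zeros (oo included) are the Q_i, and div h gives the
   linear equivalence. *)

From HB Require Import structures.
Require Import Defs.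
From mathcomp Require Import all_boot all_order all_algebra.
From mathcomp Require Import all_solvable all_field.
From mathcomp Require Import ring zify.
From mathcomp.multinomials Require Import freeg.
From Stdlib Require Classical_Prop.
Import GRing.Theory Num.Theory.
Local Open Scope ring_scope.

(** * Substitution and evaluation homomorphisms on bivariate polynomials *)

Section Substitution.
Context (K : closedFieldType).
Implicit Types (h : {poly {poly K}}) (p xi eta : {poly K}).

(* Evaluations are sealed behind Qed proofs to keep unification from unfolding
   them. *)
Fact subst2_subproof xi eta :
  {g : {rmorphism {poly {poly K}} -> {poly K}}
     | g 'X = eta & forall p, g p%:P = p \Po xi}.
Proof.
exists (horner_eval eta \o map_poly (comp_poly xi)) => [|p] /=.
  by rewrite map_polyX /horner_eval hornerX.
by rewrite map_polyC /horner_eval hornerC.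
Qed.

Definition subst2 xi eta : {rmorphism {poly {poly K}} -> {poly K}} :=
  s2val (subst2_subproof xi eta).

Lemma subst2_y xi eta : subst2 xi eta 'X = eta.
Proof. by rewrite /subst2; case: subst2_subproof. Qed.

Lemma subst2_x xi eta p : subst2 xi eta p%:P = p \Po xi.
Proof. by rewrite /subst2; case: subst2_subproof. Qed.

Fact ev_subproof (a b : K) :
  {g : {rmorphism {poly {poly K}} -> K} | forall h, g h = eval2 h a b}.
Proof. by exists (horner_eval a \o horner_eval b%:P). Qed.

Definition ev (a b : K) : {rmorphism {poly {poly K}} -> K} :=
  sval (ev_subproof a b).

Lemma evE a b h : ev a b h = eval2 h a b.
Proof. by rewrite /ev; case: ev_subproof. Qed.

Lemma ev_y a b : ev a b 'X = b.
Proof. by rewrite evE /eval2 hornerX hornerC. Qed.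

Lemma ev_x a b p : ev a b p%:P = p.[a].
Proof. by rewrite evE /eval2 hornerC. Qed.

(** Divide [h] by y - b, then the remainder, a polynomial in x, by x - a. Hence x - a and y - b
    generate the kernel of evaluation, as [van1P] requires. *)
Lemma ev_split a b h : exists c1 c2,
  h = cst (ev a b h) + c1 * (xvar K - cst a) + c2 * (yvar K - cst b).
Proof.
have /factor_theorem[c2 E2] : root (h - (h.[b%:P])%:P) b%:P.
  by rewrite /root !hornerE subrr.
have /factor_theorem[c1 E1] : root (h.[b%:P] - (ev a b h)%:P) a.
  by rewrite /root evE !hornerE subrr.
exists c1%:P, c2; rewrite /xvar /yvar /cst -polyCB -polyCM -E1 -E2 polyCB.
by rewrite [X in _ = X + _]addrC subrK addrC subrK.
Qed.

End Substitution.

Section Constants.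
Context (R : comNzRingType).

Lemma cst0 : cst (0 : R) = 0. Proof. by rewrite /cst !polyC0. Qed.
Lemma cst1 : cst (1 : R) = 1. Proof. by rewrite /cst !polyC1. Qed.

Lemma cstM (c c' : R) : cst (c * c') = cst c * cst c'.
Proof. by rewrite /cst !polyCM. Qed.

Lemma cstD (c c' : R) : cst (c + c') = cst c + cst c'.
Proof. by rewrite /cst !polyCD. Qed.

Lemma cstN (c : R) : cst (- c) = - cst c.
Proof. by rewrite /cst !polyCN. Qed.

End Constants.

Lemma ev_cst (K : closedFieldType) (a b c : K) : ev K a b (cst c) = c.
Proof. by rewrite /cst ev_x hornerC. Qed.

(** * Orders at affine points *)

Section Vanishing.
Context (K : closedFieldType) (n : nat) (f : {poly K}) (P : affine_pt n f).
Local Notation a := (xcoord P).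
Local Notation b := (ycoord P).
Local Notation F := (curve_eq n f).
Local Notation van := (vanishes P).
Implicit Types (h q : {poly {poly K}}) (c : K).

Lemma ev_curve : ev K a b F = 0.
Proof.
rewrite /curve_eq rmorphB rmorphXn /= /yvar ev_y ev_x.
by rewrite /a /b; case: P => -[x y] /= /eqP ->; rewrite subrr.
Qed.

(** The generators of the maximal ideal at [P] are kept opaque, so that algebra on them does not
    unfold bivariate polynomials. *)
Fact dxy_subproof :
  {xy : {poly {poly K}} * {poly {poly K}}
      | xy = (xvar K - cst a, yvar K - cst b)}.
Proof. by exists (xvar K - cst a, yvar K - cst b). Qed.

Definition dx := (sval dxy_subproof).1.
Definition dy := (sval dxy_subproof).2.

Lemma dxE : dx = xvar K - cst a.
Proof. by rewrite /dx (svalP dxy_subproof). Qed.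

Lemma dyE : dy = yvar K - cst b.
Proof. by rewrite /dy (svalP dxy_subproof). Qed.

Lemma vanP m h :
  van m h <-> exists (c : 'I_m.+1 -> {poly {poly K}}) (q : {poly {poly K}}),
    h = \sum_(i < m.+1) c i * dx ^+ i * dy ^+ (m - i) + q * F.
Proof. by rewrite dxE dyE. Qed.

Lemma van0 m : van m 0.
Proof.
apply/vanP; exists (fun _ => 0), 0; rewrite mul0r addr0 big1 // => i _; by rewrite !mul0r.
Qed.

Lemma vanD m h h' : van m h -> van m h' -> van m (h + h').
Proof.
move=> /vanP[c [q ->]] /vanP[c' [q' ->]]; apply/vanP; exists (fun i => c i + c' i), (q + q').
rewrite addrACA -mulrDl -big_split /=; congr (_ + _).
by apply: eq_bigr => i _; rewrite !mulrDl.
Qed.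

Lemma vanMl m h g : van m h -> van m (g * h).
Proof.
move=> /vanP[c [q ->]]; apply/vanP; exists (fun i => g * c i), (g * q).
rewrite mulrDr mulrA mulr_sumr; congr (_ + _).
by apply: eq_bigr => i _; rewrite !mulrA.
Qed.

Lemma vanMr m h g : van m h -> van m (h * g).
Proof. by rewrite mulrC; apply: vanMl. Qed.

Lemma vanN m h : van m h -> van m (- h).
Proof. by rewrite -mulN1r; apply: vanMl. Qed.

Lemma vanB m h h' : van m h -> van m h' -> van m (h - h').
Proof. by move=> vh vh'; apply/vanD/vanN. Qed.

Lemma van_sum m (I : Type) (r : seq I) (p : pred I) (G : I -> {poly {poly K}}) :
  (forall i, p i -> van m (G i)) -> van m (\sum_(i <- r | p i) G i).
Proof. by move=> vG; apply: big_ind => //; [apply: van0 | apply: vanD]. Qed.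

Lemma van_curve m q : van m (q * F).
Proof.
apply/vanP; exists (fun _ => 0), q; rewrite big1 ?add0r // => i _; by rewrite !mul0r.
Qed.

Lemma van_gen i j : van (i + j) (dx ^+ i * dy ^+ j).
Proof.
have ltij : (i < (i + j).+1)%N by rewrite ltnS leq_addr.
apply/vanP; exists (fun k => (k == Ordinal ltij)%:R), 0.
rewrite mul0r addr0 (bigD1 (Ordinal ltij)) //= eqxx mul1r addKn big1 ?addr0 //.
by move=> k /negPf ->; rewrite !mul0r.
Qed.

Lemma van_prod m m' h h' : van m h -> van m' h' -> van (m + m') (h * h').
Proof.
move=> /vanP[c [q ->]] /vanP[c' [q' ->]].
rewrite mulrDl; apply: vanD; last by rewrite mulrAC; apply: van_curve.
rewrite mulrDr; apply: vanD; last by rewrite mulrA; apply: van_curve.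
rewrite mulr_suml; apply: van_sum => i _; rewrite mulr_sumr.
apply: van_sum => j _.
have -> : (m + m' = (i + j) + ((m - i) + (m' - j)))%N.
  by have := ltn_ord i; have := ltn_ord j; lia.
have -> : c i * dx ^+ i * dy ^+ (m - i) * (c' j * dx ^+ j * dy ^+ (m' - j))
  = (c i * c' j) * dx ^+ (i + j) * dy ^+ ((m - i) + (m' - j)).
  by rewrite !exprD mulrACA; congr (_ * _); rewrite mulrACA.
rewrite -mulrA; exact/vanMl/van_gen.
Qed.

Lemma van_0 h : van 0 h.
Proof.
apply/vanP; exists (fun=> h), 0; by rewrite big_ord1 /= !expr0 !mulr1 mul0r addr0.
Qed.

Lemma vanX m h k : van m h -> van (m * k) (h ^+ k).
Proof.
move=> vh; elim: k => [|k IHk]; first by rewrite muln0; apply: van_0.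
by rewrite mulnS exprS; apply: van_prod.
Qed.

Lemma vanS m h : van m.+1 h -> van m h.
Proof.
move=> /vanP[c [q ->]]; apply: vanD (van_curve _ _).
apply: van_sum => i _; rewrite -mulrA; apply: vanMl.
(* The generator without [dx] gives up a factor [dy]; every other one gives up a factor [dx]. *)
case: (posnP i) => [->|i_gt0].
  by have := van_gen 0 m; rewrite !expr0 !mul1r subn0 exprS => /vanMl; apply.
have {1}-> : (m = i.-1 + (m.+1 - i))%N by have := ltn_ord i; lia.
rewrite -{3}(prednK i_gt0) exprS -mulrA; exact/vanMl/van_gen.
Qed.

Lemma van_le m m' h : (m' <= m)%N -> van m h -> van m' h.
Proof.
by move=> /subnK <-; elim: (m - m')%N => // k IHk /vanS.
Qed.

(** The generators and [F] all vanish at [P]; conversely, [ev_split] without its constant term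
    exhibits [h] in the ideal. *)
Lemma van1P h : van 1 h <-> ev K a b h = 0.
Proof.
split.
  move=> /vanP[c [q ->]]; rewrite rmorphD rmorphM ev_curve mulr0 addr0.
  rewrite rmorph_sum big1 // => i _; rewrite !rmorphM !rmorphXn dxE dyE !rmorphB.
  rewrite /= /xvar /yvar ev_x ev_y !ev_cst hornerX !subrr -mulrA -exprD.
  by rewrite (subnKC (ltnSE (ltn_ord i))) expr1 mulr0.
move=> h0; have [c1 [c2 ->]] := ev_split K a b h; rewrite h0 cst0 add0r -dxE -dyE.
apply: vanD; apply: vanMl.
  by have := van_gen 1 0; rewrite expr0 expr1 mulr1.
by have := van_gen 0 1; rewrite expr0 expr1 mul1r.
Qed.

Lemma van_x : van 1 dx.
Proof. by have := van_gen 1 0; rewrite expr0 expr1 mulr1. Qed.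

Lemma van_y : van 1 dy.
Proof. by have := van_gen 0 1; rewrite expr0 expr1 mul1r. Qed.

(** Pull-back along a polynomial arc through [P] lying on the curve up to order [N]: [dx] and [dy]
    become multiples of ['X]. This is how powers of a uniformizer are kept out of deeper levels of
    the filtration. *)
Lemma van_subst2 m h xi eta N : (m <= N)%N ->
  (0 < N)%N -> xi.[0] = a -> eta.[0] = b -> 'X^N %| subst2 K xi eta F ->
  van m h -> 'X^m %| subst2 K xi eta h.
Proof.
move=> le_mN N_gt0 xi0 eta0 dvF [c [q ->]].
rewrite rmorphD rmorphM dvdp_add //; last first.
  by apply/dvdp_mull/(dvdp_trans _ dvF)/dvdp_exp2l.
rewrite rmorph_sum /=; apply: (big_ind (fun p => 'X^m %| p)) => [|p p'|i _]; first exact: dvdp0.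
  exact: dvdp_add.
rewrite !rmorphM !rmorphXn !rmorphB /= /xvar /yvar /cst !subst2_x subst2_y.
rewrite comp_polyX !comp_polyC -mulrA; apply: dvdp_mull.
rewrite -{1}(subnKC (ltnSE (ltn_ord i))) exprD; apply: dvdp_mul; apply: dvdp_exp2r.
  all: rewrite -['X]subr0 -polyC0 dvdp_XsubCl /root.
  by rewrite !hornerE xi0 subrr.
by rewrite !hornerE eta0 subrr.
Qed.

(** The second clause says that [t] spans m_P / m_P^2, the third that no power of [t] falls one
    level deeper. Together they make the associated graded ring the polynomial ring K[t]. *)
Definition uniformizer t :=
  [/\ van 1 t, (forall h, van 1 h -> exists c, van 2 (h - cst c * t))
    & forall m, ~ van m.+1 (t ^+ m)].

Section Uniformizer.
Context (t : {poly {poly K}}).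
Hypothesis unif : uniformizer t.

(** The coefficient [c] may be zero, so that sums and products need no case analysis. *)
Definition leading m h (c : K) := van m.+1 (h - cst c * t ^+ m).

Lemma leadingD m h h' c c' :
  leading m h c -> leading m h' c' -> leading m (h + h') (c + c').
Proof.
move=> l l'; have := vanD _ _ _ l l'; rewrite /leading cstD.
by congr van; ring.
Qed.

Lemma vanXt m : van m (t ^+ m).
Proof. by have [/(vanX _ _ m) + _ _] := unif; rewrite mul1n. Qed.

Lemma leading_van m h c : leading m h c -> van m h.
Proof.
move/vanS => l; rewrite -(subrK (cst c * t ^+ m) h).
by apply: vanD => //; apply/vanMl/vanXt.
Qed.

(** With r = h - c t^m and r' = h' - c' t^m', the error is r h' + c t^m r', and both terms lie one
    level deeper. *)
Lemma leadingM m m' h h' c c' :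
  leading m h c -> leading m' h' c' -> leading (m + m') (h * h') (c * c').
Proof.
move=> l l'; have := leading_van _ _ _ l'.
move=> /(van_prod _ _ _ _ l); rewrite addSn => v1.
have := van_prod _ _ _ _ (vanXt m) l'; rewrite addnS => /(vanMl _ _ (cst c)) v2.
have := vanD _ _ _ v1 v2; rewrite /leading cstM exprD.
by congr van; ring.
Qed.

Lemma leading0 h : leading 0 h (ev K a b h).
Proof.
rewrite /leading expr0 mulr1; apply/van1P.
by rewrite rmorphB /= ev_cst subrr.
Qed.

Lemma leading1 h : van 1 h -> exists c, leading 1 h c.
Proof. by have [_ + _] := unif; apply. Qed.

Lemma leading_zero m h : van m.+1 h -> leading m h 0.
Proof. by rewrite /leading cst0 mul0r subr0. Qed.

Lemma leadingX m h c k : leading m h c -> leading (m * k) (h ^+ k) (c ^+ k).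
Proof.
move=> l; elim: k => [|k IHk].
  by rewrite muln0 !expr0; have := leading0 1; rewrite rmorph1.
by rewrite mulnS !exprS; apply: leadingM.
Qed.

(** In each generator, replace the coefficient by its value at [P], and [dx], [dy] by their own
    leading coefficients. *)
Lemma van_leading m h : van m h -> exists c, leading m h c.
Proof.
have [cx lx] := leading1 _ van_x; have [cy ly] := leading1 _ van_y.
move=> /vanP[c [q ->]].
have: exists e, leading m (\sum_(i < m.+1) c i * dx ^+ i * dy ^+ (m - i)) e.
  apply: (big_ind (fun h => exists e, leading m h e)) => [|h1 h2 [e1 l1] [e2 l2]|i _].
  - by exists 0; apply/leading_zero/van0.
  - by exists (e1 + e2); apply: leadingD.
  exists (ev K a b (c i) * cx ^+ i * cy ^+ (m - i)).
  have lcx := leadingM _ _ _ _ _ _ (leading0 (c i)) (leadingX _ _ _ i lx).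
  have := leadingM _ _ _ _ _ _ lcx (leadingX _ _ _ (m - i) ly).
  by rewrite add0n !mul1n subnKC // -ltnS.
move=> [e le]; exists (e + 0).
exact: leadingD _ _ _ _ _ le (leading_zero _ _ (van_curve _ _)).
Qed.

Lemma leading_neq0 m h c : leading m h c -> c != 0 -> has_order P h m.
Proof.
move=> l c_neq0; split; first exact: leading_van l.
move=> v; have := vanB _ _ _ v l; rewrite opprB addrC subrK.
move/(vanMl _ _ (cst c^-1)); rewrite mulrA -cstM mulVf //.
by rewrite cst1 mul1r; have [_ _ /(_ m)] := unif.
Qed.

Lemma has_order_leading m h : has_order P h m -> exists2 c, c != 0 & leading m h c.
Proof.
move=> [v nv]; have [c l] := van_leading _ _ v; exists c => //.
apply/eqP => c0; apply: nv; move: l.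
by rewrite c0 /leading cst0 mul0r subr0.
Qed.

(** Leading coefficients multiply, and [K] has no zero divisors. *)
Lemma has_orderM m m' h h' :
  has_order P h m -> has_order P h' m' -> has_order P (h * h') (m + m').
Proof.
move=> /has_order_leading[c c0 l] /has_order_leading[c' c'0 l'].
by apply: leading_neq0 (leadingM _ _ _ _ _ _ l l') _; rewrite mulf_neq0.
Qed.

Lemma has_order_unif : has_order P t 1.
Proof. by split; [have [] := unif | have [_ _ /(_ 1%N)] := unif]. Qed.

End Uniformizer.

Lemma has_order_inj h m m' : has_order P h m -> has_order P h m' -> m = m'.
Proof.
move=> [v nv] [v' nv']; case: (ltngtP m m') => // lt_m.
  by case: nv; apply: van_le v'.
by case: nv'; apply: van_le v.
Qed.

Lemma has_order_ge h m k : has_order P h m -> van k h -> (k <= m)%N.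
Proof.
by move=> [v nv] vk; rewrite leqNgt; apply/negP => /van_le/(_ vk).
Qed.

Lemma has_order0 h : ev K a b h != 0 -> has_order P h 0.
Proof.
by move=> h0; split; [apply: van_0 | move/van1P/eqP; apply/negP].
Qed.

(** Level 0 of the filtration is everything, so there is a last level below [m] containing [h].
    Membership is not decided, hence the excluded middle. *)
Lemma exists_order_le h m : ~ van m h -> exists2 k, (k < m)%N & has_order P h k.
Proof.
elim: m => [|m IHm] nv; first by case: nv; apply: van_0.
case: (Classical_Prop.classic (van m h)) => [v|/IHm[k lt_k ok]].
  by exists m.
by exists k => //; apply: ltnW.
Qed.

End Vanishing.

(** * Taylor expansion and Hensel lifting *)

Lemma taylor1 (R : comNzRingType) (p : {poly R}) (z e : R) :
  exists w, p.[z + e] = p.[z] + p^`().[z] * e + w * e ^+ 2.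
Proof.
elim/poly_ind: p => [|p c [w IHp]].
  by exists 0; rewrite deriv0 !horner0; ring.
exists (p^`().[z] + w * (z + e)).
rewrite derivMXaddC hornerD hornerMX !hornerMXaddC IHp; ring.
Qed.

(** This is [taylor1] over the polynomial ring, at the point c + ('X - c) = 'X. *)
Lemma poly_taylor1 (R : comNzRingType) (p : {poly R}) (c : R) :
  exists w, p = p.[c]%:P + p^`().[c]%:P * ('X - c%:P) + w * ('X - c%:P) ^+ 2.
Proof.
have [w] := taylor1 _ (map_poly polyC p) c%:P ('X - c%:P).
rewrite [c%:P + _]addrC subrK deriv_map !horner_map /= => E.
by exists w; rewrite -E -[LHS]comp_polyXr.
Qed.

Section Hensel.
Context (K : closedFieldType) (G : {poly {poly K}}) (z0 : K).
Hypotheses (G0 : eval2 G 0 z0 = 0) (dG0 : eval2 G^`() 0 z0 != 0).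

Lemma horner_at0 (H : {poly {poly K}}) (z : {poly K}) :
  H.[z].[0] = H.[z.[0]%:P].[0].
Proof.
have E (x : {poly K}) : H.[x].[0] = (map_poly (horner_eval 0) H).[x.[0]].
  by have := horner_map (horner_eval (0 : K)) H x; rewrite /horner_eval /= => ->.
by rewrite !E hornerC.
Qed.

Lemma dvdXn0 (p : {poly K}) : ('X %| p)%R = (p.[0] == 0).
Proof. by rewrite -['X]subr0 -polyC0 dvdp_XsubCl. Qed.

(** Newton iteration; the inner variable of [G] is the local parameter, and the root [z] is a
    polynomial in it. *)
Lemma hensel m : exists2 z : {poly K}, z.[0] = z0 & ('X^(m.+1) %| G.[z])%R.
Proof.
elim: m => [|m [z zz0 /dvdpP[u Eu]]].
  by exists z0%:P; rewrite ?hornerC // expr1 dvdXn0 -/(eval2 G 0 z0) G0.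
(* Modulo one more power of ['X], the correction changes the cofactor [u] by [c] times the
   derivative at (0, z0); this choice cancels the constant term of [u]. *)
pose c := - u.[0] / eval2 G^`() 0 z0.
exists (z + c%:P * 'X^(m.+1)); first by rewrite !hornerE expr0n /= mulr0 addr0.
have [w ->] := taylor1 _ G z (c%:P * 'X^(m.+1)).
have -> : G.[z] + G^`().[z] * (c%:P * 'X^(m.+1)) + w * (c%:P * 'X^(m.+1)) ^+ 2
  = 'X^(m.+1) * (u + G^`().[z] * c%:P + w * c%:P ^+ 2 * 'X^(m.+1)).
  by rewrite Eu; ring.
rewrite [in X in X %| _]exprSr dvdp_mul2l ?expf_neq0 ?polyX_eq0 //.
rewrite dvdXn0 !hornerE horner_at0 zz0 expr0n /= mulr0 addr0.
rewrite -/(eval2 G^`() 0 z0) /c; by apply/eqP; field; exact: dG0.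
Qed.

End Hensel.

(** * Uniformizers at the affine points *)

Section LocalUniformizer.
Context (K : closedFieldType) (n : nat) (f : {poly K}) (P : affine_pt n f).
Hypotheses (n_gt1 : (1 < n)%N) (n_unit : n%:R != 0 :> K).
Hypothesis f_simple : forall a, f.[a] = 0 -> f^`().[a] != 0.
Local Notation a := (xcoord P).
Local Notation b := (ycoord P).
Local Notation F := (curve_eq n f).
Local Notation van := (vanishes P).
Local Notation dx := (dx K n f P).
Local Notation dy := (dy K n f P).

Lemma on_curve : b ^+ n = f.[a].
Proof. by rewrite /a /b; case: P => -[x y] /= /eqP. Qed.

(** The linear part of [F] at [P]: expand y^n and f(x) to first order; the constant terms cancel
    because [P] is on the curve. *)
Lemma tangent :
  van 2 (cst (b ^+ n.-1 *+ n) * dy - cst (f^`().[a]) * dx).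
Proof.
have [w Ew] := poly_taylor1 _ f a.
have [w' Ew'] := poly_taylor1 _ ('X^n : {poly {poly K}}) b%:P.
have vF := van_curve K n f P 2 1; rewrite mul1r in vF.
have /(vanMl K n f P _ _ w'%R) v1 := vanX K n f P _ _ 2 (van_y K n f P).
have /(vanMl K n f P _ _ w%:P) v2 := vanX K n f P _ _ 2 (van_x K n f P).
have := vanB K n f P _ _ _ (vanD K n f P _ _ _ vF v2) v1.
congr van.
have := congr1 polyC Ew; rewrite !polyCD 2!polyCM polyC_exp polyCB => Ef.
move: Ew'; rewrite derivXn hornerMn !hornerXn -!polyC_exp on_curve -polyCMn => Ey.
rewrite dxE dyE /curve_eq /yvar /xvar /cst {}Ey {}Ef.
move: (f.[a]%:P%:P) ((b ^+ n.-1 *+ n)%:P%:P) (f^`().[a]%:P%:P) => fa nb f'a.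
move: ('X - b%:P%:P) ('X%:P - a%:P%:P) (w%:P) => *.
ring.
Qed.

(** Replacing the coefficients of [dx] and [dy] by their values at [P] costs only an element of
    level 2. *)
Lemma van1_dxy h : van 1 h -> exists c1 c2,
  van 2 (h - (cst c1 * dx + cst c2 * dy)).
Proof.
move=> /vanP[c [q ->]]; exists (ev K a b (c 1%:R)), (ev K a b (c 0)).
rewrite big_ord_recl big_ord1 /= expr0 mulr1 subn0 subnn expr0 mulr1 !expr1.
have -> : fintype.lift (ord0 : 'I_2) ord0 = 1 by apply/val_inj.
have van_diff g : van 1 (g - cst (ev K a b g)).
  by apply/van1P; rewrite rmorphB ev_cst subrr.
have v1 := van_prod K n f P _ _ _ _ (van_diff (c 1%:R)) (van_x K n f P).
have v0 := van_prod K n f P _ _ _ _ (van_diff (c 0)) (van_y K n f P).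
have := vanD K n f P _ _ _ (vanD K n f P _ _ _ v1 v0) (van_curve K n f P 2 q).
congr van; rewrite -/dx -/dy.
move: (c 1%:R) (c 0) dx dy F => c1 c0 x y G.
by ring.
Qed.

(** As n b^(n-1) is invertible, [tangent] expresses [dy] through [dx]. For the powers, Hensel
    lifting solves y^n = f(a + T) for y, and [dx] becomes T on this arc. *)
Lemma uniformizer_x : b != 0 -> uniformizer K n f P dx.
Proof.
move=> b_neq0; have nb0 : b ^+ n.-1 *+ n != 0.
  by rewrite -mulr_natr mulf_neq0 ?expf_neq0.
split=> [|h /van1_dxy[c1 [c2 v]]|m].
- exact: van_x.
- pose e := c2 / (b ^+ n.-1 *+ n).
  exists (c1 + e * f^`().[a]).
  have := vanD K n f P _ _ _ v (vanMl K n f P _ _ (cst e) tangent).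
  congr van; have -> : c2 = e * (b ^+ n.-1 *+ n) by rewrite divfK.
  rewrite cstD !cstM; move: (cst _) (cst _) (cst _) (cst _) dx dy => *; ring.
pose G : {poly {poly K}} := 'X^n - (f \Po ('X + a%:P))%:P.
have [||z z0 dvz] := hensel K G b _ _ m.
- by rewrite /eval2 !hornerE horner_comp !hornerE ?add0r -on_curve subrr.
- rewrite /eval2 derivB derivC subr0 derivXn hornerMn hornerXn -polyC_exp.
  by rewrite hornerMn hornerC.
move/(van_subst2 K n f P _ _ ('X + a%:P) z m.+1).
rewrite rmorphB rmorphXn /yvar subst2_y subst2_x.
have <- : G.[z] = z ^+ n - (f \Po ('X + a%:P)) by rewrite !hornerE.
have xi0 : ('X + a%:P).[0] = a by rewrite !hornerE.
move=> /(_ (leqnn _) isT xi0 z0 dvz).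
rewrite rmorphXn dxE rmorphB /= /xvar /cst !subst2_x comp_polyX comp_polyC addrK.
by rewrite dvdp_Pexp2l ?size_polyX // ltnn.
Qed.

(** Here f(a) = 0, so f'(a) is invertible; since n > 1 the [dy] term of [tangent] is zero, and [dx]
    lies in level 2. *)
Lemma uniformizer_y : b = 0 -> uniformizer K n f P dy.
Proof.
move=> b0; have fa0 : f.[a] = 0.
  by rewrite -on_curve b0 expr0n; case: (n) n_gt1.
have f'0 := f_simple _ fa0.
have tan0 : van 2 dx.
  have := vanMl K n f P _ _ (cst (- (f^`().[a])^-1)) tangent.
  rewrite b0 expr0n; have -> : (n.-1 == 0)%N = false by case: (n) n_gt1 => [|[]].
  rewrite mul0rn cst0 mul0r sub0r mulrN mulrA -cstM -mulNr.
  by rewrite -cstN mulNr opprK mulVf // cst1 mul1r.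
split=> [|h /van1_dxy[c1 [c2 v]]|m].
- exact: van_y.
- exists c2; have := vanD K n f P _ _ _ v (vanMl K n f P _ _ (cst c1) tan0).
  by congr van; move: (_ * dx) (_ * dy) => *; ring.
(* The roles are exchanged: y = T is the parameter, and f(x) = T^n is solved for x, the outer
   variable of [G]. *)
pose G : {poly {poly K}} := map_poly polyC f - ('X^n)%:P.
have [||z z0 dvz] := hensel K G a _ _ m.
- rewrite /eval2 !hornerE horner_map /= hornerC fa0 expr0n.
  by case: (n) n_gt1 => // n' _; rewrite subrr.
- by rewrite /eval2 derivB derivC subr0 deriv_map horner_map /= hornerC.
move/(van_subst2 K n f P _ _ z 'X m.+1).
rewrite rmorphB rmorphXn /yvar subst2_y subst2_x.
have -> : 'X^n - (f \Po z) = - G.[z] by rewrite !hornerE opprB.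
rewrite dvdpNr hornerX b0 => /(_ (leqnn _) isT z0 erefl dvz).
rewrite rmorphXn dyE rmorphB /= /yvar /cst subst2_x subst2_y comp_polyC.
rewrite b0 subr0.
by rewrite dvdp_Pexp2l ?size_polyX // ltnn.
Qed.

Lemma exists_uniformizer : exists t, uniformizer K n f P t.
Proof.
have [b0|b_neq0] := eqVneq b 0; first by exists dy; apply: uniformizer_y.
by exists dx; apply: uniformizer_x.
Qed.

End LocalUniformizer.

Lemma rmorph_poly2_ext (R S : nzRingType) (g g' : {rmorphism {poly R} -> S}) :
  g 'X = g' 'X -> (forall c, g c%:P = g' c%:P) -> g =1 g'.
Proof.
move=> gX gC; elim/poly_ind => [|p c IHp]; first by rewrite !rmorph0.
by rewrite !rmorphD !rmorphM IHp gX gC.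
Qed.

Lemma exists_nth_root (K : closedFieldType) n (c : K) :
  (0 < n)%N -> exists z, z ^+ n = c.
Proof.
move=> n_gt0; have /closed_rootP[z] : size ('X^n - c%:P) != 1.
  by rewrite size_XnsubC // eqSS -lt0n.
by rewrite /root !hornerE subr_eq0 => /eqP; exists z.
Qed.

(** * Pole orders at infinity *)

Section PoleOrder.
Context (K : closedFieldType) (n d : nat) (f : {poly K}).
Hypotheses (n_gt1 : (1 < n)%N) (deg_f : size f = d.+1) (n_d_coprime : coprime n d).
Local Notation F := (curve_eq n f).
Implicit Types (h q r : {poly {poly K}}) (c : K).

Let n_gt0 : (0 < n)%N. Proof. exact: ltnW. Qed.

Let d_gt0 : (0 < d)%N.
Proof.
move: n_d_coprime; case: (d) => //.
by rewrite /coprime gcdn0; case: (n) n_gt1 => [|[]].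
Qed.

Lemma curve_monic : F \is monic.
Proof. exact: monicXnsubC. Qed.

Lemma size_curve : size F = n.+1.
Proof. exact: size_XnsubC. Qed.

Definition curve_rem h := Pdiv.Ring.rmodp h F.

Lemma size_red h : (size (curve_rem h) <= n)%N.
Proof.
by rewrite -ltnS -size_curve Pdiv.Ring.ltn_rmodpN0 // monic_neq0 // curve_monic.
Qed.

Lemma redE h : exists q, h = q * F + curve_rem h.
Proof. exists (Pdiv.Ring.rdivp h F); exact: (Pdiv.RingMonic.rdivp_eq curve_monic). Qed.

Lemma red_unique h q r : h = q * F + r -> (size r <= n)%N -> curve_rem h = r.
Proof.
move=> -> sr; apply: (Pdiv.RingMonic.rmodp_addl_mul_small curve_monic).
by rewrite size_curve.
Qed.

Lemma red_small h : (size h <= n)%N -> curve_rem h = h.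
Proof. by apply: (red_unique _ 0); rewrite mul0r add0r. Qed.

Lemma red_curve q : curve_rem (q * F) = 0.
Proof. by apply: (red_unique _ q); rewrite ?addr0 // size_poly0. Qed.

Lemma redD h h' : curve_rem (h + h') = curve_rem h + curve_rem h'.
Proof.
have [q Eq] := redE h; have [q' Eq'] := redE h'; apply: (red_unique _ (q + q')).
  by rewrite {1}Eq {1}Eq' mulrDl addrACA.
by rewrite (leq_trans (size_polyD _ _)) // geq_max !size_red.
Qed.

Definition nonzero_on_curve h : bool := curve_rem h != 0.

Lemma red0P h : curve_rem h = 0 <-> exists q, h = q * F.
Proof.
split=> [h0|[q ->]]; last exact: red_curve.
by have [q] := redE h; rewrite h0 addr0; exists q.
Qed.

(** The degree in ['X] stands for the pole order. [c] is a parameter because multiplying y by a root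
    of unity rescales it. *)
Definition infmap c := subst2 K 'X^n (c *: 'X^d).

Lemma infmapE c h :
  infmap c h = \sum_(j < size h) (h`_j \Po 'X^n) * (c *: 'X^d) ^+ j.
Proof.
rewrite -{1}[h]coefK poly_def rmorph_sum; apply: eq_bigr => j _.
by rewrite -mul_polyC rmorphM rmorphXn /infmap subst2_x subst2_y.
Qed.

Lemma size_inf_term c (p : {poly K}) j : c != 0 -> p != 0 ->
  size ((p \Po 'X^n) * (c *: 'X^d) ^+ j) = (monom_pole n f ((size p).-1, j)).+1.
Proof.
move=> c0 p0; rewrite exprZn -scalerAr -exprM size_scale ?expf_neq0 //.
have pX0 : p \Po 'X^n != 0.
  by rewrite comp_poly_eq0 // size_polyXn.
rewrite size_mulXn // -(prednK (_ : 0 < size (p \Po 'X^n))%N) ?lt0n ?size_poly_eq0 //.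
by rewrite size_comp_poly size_polyXn /monom_pole deg_f /= addnC addSn mulnC addnC.
Qed.

(** Equal weights make [n] divide d (j' - j), hence j' - j by coprimality, and this difference is
    below [n]. *)
Lemma inf_weight_inj (i j i' j' : nat) : (j < n)%N -> (j' < n)%N ->
  monom_pole n f (i, j) = monom_pole n f (i', j') -> (i, j) = (i', j').
Proof.
rewrite /monom_pole deg_f /= => lt_j lt_j' E.
suff jE : j = j'.
  by move: E; rewrite jE => /addIn/eqP; rewrite eqn_mul2l -[n == 0%N]negbK -lt0n n_gt0 => /eqP ->.
wlog le_jj' : i j i' j' lt_j lt_j' E / (j <= j')%N.
  move=> W; case/orP: (leq_total j j') => le_j; first exact: W E le_j.
  by apply/esym; apply: W (esym E) le_j.
have : (n %| d * (j' - j))%N.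
  apply/dvdnP; exists (i - i')%N; rewrite mulnBr mulnBl; lia.
rewrite Gauss_dvdr // => /dvdnP[[|k] Ek]; first by lia.
by have := leq_pmull n (ltn0Sn k); lia.
Qed.

Definition max_pole r : nat :=
  \max_(j < size r | (r`_j != 0)%R) monom_pole n f ((size (r`_j)%R).-1, val j).

(** By [inf_weight_inj] the terms have pairwise distinct degrees, so the top one cannot cancel. *)
Lemma size_infmap c r : c != 0 -> (size r <= n)%N -> r != 0 ->
  size (infmap c r) = (max_pole r).+1.
Proof.
move=> c0 sr r0.
have sr0 : ((size r).-1 < size r)%N by rewrite prednK // lt0n size_poly_eq0.
pose G (j : 'I_(size r)) := monom_pole n f ((size r`_j).-1, val j).
have: r`_(Ordinal sr0) != 0 by rewrite -/(lead_coef r) lead_coef_eq0.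
move=> /(@arg_maxnP _ (Ordinal sr0) (fun j => r`_j != 0) G)[j0 j0N max_j0].
have -> : max_pole r = G j0.
  apply/eqP; rewrite eqn_leq; apply/andP; split; first exact/bigmax_leqP.
  exact: (@leq_bigmax_cond _ (fun j : 'I__ => r`_j != 0) G).
rewrite infmapE (bigD1 j0) //= size_polyDl size_inf_term //.
rewrite ltnS; apply: (leq_trans (size_sum _ _ _)); apply/bigmax_leqP => j jj0.
have [->|jN] := eqVneq r`_j 0; first by rewrite comp_poly0 mul0r size_poly0.
have := max_j0 j jN; rewrite /= -/(G j) => le_j.
rewrite size_inf_term // -/(G j) ltn_neqAle le_j andbT; apply: contra jj0 => /eqP.
have ltn_r (k : 'I_(size r)) : (k < n)%N := leq_trans (ltn_ord k) sr.
by move=> /(inf_weight_inj _ _ _ _ (ltn_r j) (ltn_r j0)) [_ /val_inj ->].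
Qed.

(** Weighted degree, with x of weight [n] and y of weight [d]; it serves also for polynomials not
    yet reduced modulo the curve, such as products. *)
Definition wtle N h := forall i j, (h`_j)`_i != 0 -> (n * i + d * j <= N)%N.

Lemma wtleD N h h' : wtle N h -> wtle N h' -> wtle N (h + h').
Proof.
move=> w w' i j; rewrite !coefD.
have [->|/w //] := eqVneq (h`_j)`_i 0; rewrite add0r; exact: w'.
Qed.

Lemma wtleN N h : wtle N h -> wtle N (- h).
Proof. by move=> w i j; rewrite !coefN oppr_eq0; apply: w. Qed.

Lemma wtleM N N' h h' : wtle N h -> wtle N' h' -> wtle (N + N') (h * h').
Proof.
move=> w w' i j; apply: contraNT => Nij.
rewrite coefM coef_sum; apply/eqP/big1 => k _; rewrite coefM; apply: big1 => l _.
have [->|/w le1] := eqVneq (h`_k)`_l 0; first by rewrite mul0r.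
have [->|/w' le2] := eqVneq (h'`_(j - k))`_(i - l) 0; first by rewrite mulr0.
case/negP: Nij; apply: leq_trans (leq_add le1 le2).
have lek := ltnSE (ltn_ord k); have lel := ltnSE (ltn_ord l).
by rewrite addnACA -!mulnDr !subnKC.
Qed.

Lemma wtle_leq N N' h : (N <= N')%N -> wtle N h -> wtle N' h.
Proof. by move=> le_N w i j /w /leq_trans; apply. Qed.

Lemma wtle_monom (p : {poly K}) j : wtle (n * (size p).-1 + d * j) (p *: 'X^j).
Proof.
move=> i k; rewrite coefZ coefXn; case: (eqVneq k j) => [->|_]; last by rewrite mulr0 coef0 eqxx.
rewrite mulr1 leq_add2r => pi0; rewrite leq_mul2l; apply/orP; right.
rewrite -ltnS; apply: leq_trans (leqSpred _); apply: contraR pi0.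
by rewrite -leqNgt => /leq_sizeP ->.
Qed.

Lemma wtle_curve : wtle (n * d) F.
Proof.
apply: wtleD; last apply: wtleN.
  by have := wtle_monom 1 n; rewrite scale1r size_poly1 /= muln0 add0n mulnC.
have := wtle_monom f 0; rewrite deg_f /= muln0 addn0.
by rewrite expr0 alg_polyC.
Qed.

Lemma wtle_infmap N h c : c != 0 -> wtle N h -> (size (infmap c h) <= N.+1)%N.
Proof.
move=> c0 w; rewrite infmapE; apply: (leq_trans (size_sum _ _ _)).
apply/bigmax_leqP => j _.
have [->|jN] := eqVneq h`_j 0; first by rewrite comp_poly0 mul0r size_poly0.
rewrite size_inf_term // ltnS /monom_pole deg_f /=; apply: w.
by rewrite -/(lead_coef _) lead_coef_eq0.
Qed.

Lemma wtle_max_pole r : wtle (max_pole r) r.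
Proof.
move=> i j ij0.
have j0 : r`_j != 0 by apply: contraNneq ij0 => ->; rewrite coef0.
have ltj : (j < size r)%N.
  by rewrite ltnNge; apply: contra j0 => /leq_sizeP/(_ j (leqnn _))/eqP.
have le_i : (i <= (size (r`_j)%R).-1)%N.
  rewrite -ltnS; apply: leq_trans (leqSpred _).
  by rewrite ltnNge; apply: contra ij0 => /leq_sizeP/(_ i (leqnn _))/eqP.
pose G (j : 'I_(size r)) := monom_pole n f ((size r`_j).-1, val j).
apply: leq_trans (@leq_bigmax_cond _ (fun j : 'I__ => r`_j != 0) G (Ordinal ltj) j0).
by rewrite /G /monom_pole deg_f /= leq_add2r leq_mul2l le_i orbT.
Qed.

Lemma max_pole_le N r : wtle N r -> (max_pole r <= N)%N.
Proof.
move=> w; apply/bigmax_leqP => j j0; rewrite /monom_pole deg_f /=; apply: w.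
by rewrite -/(lead_coef _) lead_coef_eq0.
Qed.

(** The terms of degree n d from y^n and from the leading term of [f] cancel; size at most n d means
    degree below n d. *)
Lemma size_infmap_curve c : c ^+ n = lead_coef f -> (size (infmap c F) <= n * d)%N.
Proof.
move=> cn; rewrite rmorphB rmorphXn /infmap /yvar subst2_y subst2_x.
rewrite exprZn cn -exprM; apply/leq_sizeP => i le_i.
rewrite coefB coefZ coefXn coef_comp_poly_Xn // lead_coefE deg_f /=.
case: (ltngtP (n * d)%N i) le_i => // [lt_i _|<- _].
  rewrite (_ : i == _ = false) ?mulr0 ?sub0r; last by lia.
  case: ifP => [/dvdnP[k ik]|_]; last by rewrite oppr0.
  rewrite ik mulnK // nth_default ?oppr0 // deg_f.
  by move: lt_i; rewrite ik mulnC ltn_mul2r n_gt0.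
by rewrite mulnC eqxx dvdn_mull // mulnK // mulr1 subrr.
Qed.

(* Reduction modulo the curve replaces y^n by f(x), of the same weight nd; the
   quotient part then only contributes lower order terms at infinity, because
   c^n = lead_coef f makes the curve itself drop below weight nd. *)
Lemma red_weight c N h : c != 0 -> c ^+ n = lead_coef f -> wtle N h ->
  exists q, [/\ h = q * F + curve_rem h, wtle N (curve_rem h)
              & (size (infmap c (q * F)%R) <= N)%N].
Proof.
move=> c0 cn; have [m] := ubnP (size h); elim: m h => // m IHm h lt_m w.
have [le_hn|lt_nh] := leqP (size h) n.
  by exists 0; rewrite red_small // mul0r add0r rmorph0 size_poly0.
(* One step of long division by the monic [F]: [mon * F] cancels the top power of y in [h] and has
   weight at most [N]. *)
pose s := (size h).-1; pose p := lead_coef h; pose mon := p *: 'X^(s - n).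
have le_ns : (n <= s)%N by rewrite /s -ltnS prednK // (leq_trans _ lt_nh).
have p0 : p != 0 by rewrite lead_coef_eq0 -size_poly_gt0 (leq_trans _ lt_nh).
have le_N : (n * (size p).-1 + d * (s - n) + n * d <= N)%N.
  have := w (size p).-1 s; rewrite -/p -lead_coefE lead_coef_eq0 => /(_ p0).
  by rewrite -addnA [(n * d)%N]mulnC -mulnDr subnK.
have wmon : wtle N (mon * F).
  exact: wtle_leq _ _ _ le_N (wtleM _ _ _ _ (wtle_monom _ _) wtle_curve).
have lt_size : (size (h - mon * F)%R < size h)%N.
  rewrite -[X in (_ < X)%N]prednK ?(leq_trans _ lt_nh) // ltnS -/s.
  apply/leq_sizeP => k le_k; rewrite coefB /mon -scalerAl coefZ coefXnM.
  have -> : (k < s - n)%N = false by lia.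
  rewrite /= /curve_eq coefB coefXn coefC.
  have -> : (k - (s - n) == 0)%N = false by lia.
  move: le_k; rewrite subr0 leq_eqVlt => /predU1P[<-|lt_k].
    rewrite (_ : (s - (s - n) == n)%N) ?mulr1; last by lia.
    by rewrite -/(lead_coef h) subrr.
  rewrite (_ : (k - (s - n) == n)%N = false) ?mulr0 ?subr0; last by lia.
  by rewrite nth_default // (leq_trans (leqSpred _)).
have [|q [Eq wr szq]] := IHm _ (leq_trans lt_size (ltnSE lt_m)).
  exact/wtleD/wtleN.
have redE' : curve_rem (h - mon * F) = curve_rem h.
  by rewrite redD -mulNr red_curve addr0.
rewrite redE' in Eq wr; exists (mon + q); split=> //.
  by rewrite mulrDl -addrA -Eq addrC subrK.
rewrite mulrDl rmorphD (leq_trans (size_polyD _ _)) // geq_max szq andbT.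
rewrite rmorphM; apply: leq_trans (size_polyMleq _ _) _.
apply: leq_trans le_N; have := wtle_infmap _ _ _ c0 (wtle_monom p (s - n)).
have := size_infmap_curve _ cn; rewrite -/mon; lia.
Qed.

Lemma exists_lead_root : exists2 c, c != 0 & c ^+ n = lead_coef f.
Proof.
have [c cn] := exists_nth_root K n (lead_coef f) n_gt0; exists c => //.
apply/eqP => c0; move/eqP: cn; rewrite c0 expr0n gtn_eqF //= eq_sym.
by rewrite lead_coef_eq0 -size_poly_eq0 deg_f.
Qed.

Lemma pole_orderE h : pole_order n f h = max_pole (curve_rem h).
Proof. by []. Qed.

Lemma size_infmap_red c h : c != 0 -> nonzero_on_curve h ->
  size (infmap c (curve_rem h)) = (pole_order n f h).+1.
Proof. by move=> c0 hN; rewrite size_infmap ?size_red. Qed.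

(** The product of the two remainders has degree at infinity exactly the sum of the pole orders.
    Reducing it subtracts a multiple of [F] that [red_weight] puts strictly below, so the degree
    survives and the result is nonzero. *)
Lemma pole_orderM h h' : nonzero_on_curve h -> nonzero_on_curve h' ->
  nonzero_on_curve (h * h') /\
  pole_order n f (h * h') = (pole_order n f h + pole_order n f h')%N.
Proof.
move=> hN h'N; have [c c0 cn] := exists_lead_root.
have [q Eq] := redE h; have [q' Eq'] := redE h'.
have := wtleM _ _ _ _ (wtle_max_pole (curve_rem h)) (wtle_max_pole (curve_rem h')).
move=> /(red_weight _ _ _ c0 cn)[u [Eu _ szu]].
have Er : curve_rem (h * h') = curve_rem (curve_rem h * curve_rem h').
  apply: (red_unique _ (q * h' + curve_rem h * q' + u)); last exact: size_red.
  have key (G a b s : {poly {poly K}}) : a * b = u * G + s ->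
      (q * G + a) * (q' * G + b) = (q * (q' * G + b) + a * q' + u) * G + s.
    move=> E; transitivity ((q * (q' * G + b) + a * q') * G + a * b); first by ring.
    by rewrite E; ring.
  by have := key F _ _ _ Eu; rewrite -Eq -Eq'.
have szp : size (infmap c (curve_rem h * curve_rem h'))
           = (pole_order n f h + pole_order n f h').+1.
  rewrite rmorphM size_mul ?size_infmap_red //; first by rewrite addSn addnS.
    by rewrite -size_poly_eq0 size_infmap_red.
  by rewrite -size_poly_eq0 size_infmap_red.
have szr : size (infmap c (curve_rem (h * h')))
           = (pole_order n f h + pole_order n f h').+1.
  have -> : curve_rem (h * h') = curve_rem h * curve_rem h' - u * F.
    by rewrite Eu -Er [u * F + _]addrC addrK.
  by rewrite rmorphB size_polyDl szp // size_polyN ltnS.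
have rN : curve_rem (h * h') != 0.
  by apply/eqP => r0; move: szr; rewrite r0 rmorph0 size_poly0.
by split=> //; apply: succn_inj; rewrite -(size_infmap_red c).
Qed.

Lemma nzM h h' : nonzero_on_curve h -> nonzero_on_curve h' -> nonzero_on_curve (h * h').
Proof. by move=> hN /(pole_orderM _ _ hN)[]. Qed.

Lemma pole_order_x (p : {poly K}) : p != 0 ->
  nonzero_on_curve p%:P /\ pole_order n f p%:P = (n * (size p).-1)%N.
Proof.
move=> p0; have E : curve_rem p%:P = p%:P.
  by rewrite red_small // size_polyC p0 ltnW.
split; first by rewrite /nonzero_on_curve E polyC_eq0.
apply: succn_inj; rewrite -(size_infmap_red 1) ?oner_neq0 /nonzero_on_curve ?E ?polyC_eq0 //.
rewrite /infmap subst2_x; have := size_inf_term 1 p 0 (oner_neq0 _) p0.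
by rewrite expr0 mulr1 /monom_pole muln0 addn0.
Qed.

Fact rot_subproof c : {g : {rmorphism {poly {poly K}} -> {poly {poly K}}}
  | g 'X = cst c * 'X & forall p, g p%:P = p%:P}.
Proof.
exists (comp_poly (cst c * 'X)) => [|p] /=; first exact: comp_polyX.
exact: comp_polyC.
Qed.

(* The automorphism (x, y) |-> (x, c y), which preserves the curve if c^n = 1. *)
Definition rot c : {rmorphism {poly {poly K}} -> {poly {poly K}}} :=
  s2val (rot_subproof c).

Lemma rot_y c : rot c 'X = cst c * 'X.
Proof. exact: (s2valP (rot_subproof c)). Qed.

Lemma rot_x c p : rot c p%:P = p%:P.
Proof. exact: (s2valP' (rot_subproof c)). Qed.

Lemma rotM c c' h : rot c (rot c' h) = rot (c * c') h.
Proof.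
have := rmorph_poly2_ext _ _ (rot c \o rot c') (rot (c * c')); apply => [|p] /=.
  by rewrite !rot_y rmorphM rot_x rot_y mulrCA mulrA cstM.
by rewrite !rot_x.
Qed.

Lemma rot1 h : rot 1 h = h.
Proof.
have := rmorph_poly2_ext _ _ (rot 1) idfun; apply => [|p] /=.
  by rewrite rot_y cst1 mul1r.
by rewrite rot_x.
Qed.

Lemma coef_rot c h j : (rot c h)`_j = c ^+ j *: h`_j.
Proof.
have -> : rot c h = \poly_(i < size h) (c ^+ i *: h`_i).
  rewrite -{1}[h]coefK !poly_def rmorph_sum; apply: eq_bigr => i _.
  rewrite -mul_polyC rmorphM rmorphXn rot_x rot_y exprMn /cst -!polyC_exp.
  by rewrite mulrA -polyCM mul_polyC mulrC mul_polyC.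
by rewrite coef_poly; case: ltnP => // ?; rewrite nth_default // scaler0.
Qed.

Section RootOfUnity.
Context (z : K).
Hypothesis zn1 : z ^+ n = 1.

Let z_neq0 : z != 0.
Proof. by apply/eqP => z0; move/eqP: zn1; rewrite z0 expr0n gtn_eqF // eq_sym oner_eq0. Qed.

Lemma rot_curve : rot z F = F.
Proof.
rewrite rmorphB rmorphXn /yvar rot_x rot_y exprMn /cst -!polyC_exp zn1.
by rewrite !polyC1 mul1r.
Qed.

Lemma red_rot h : curve_rem (rot z h) = rot z (curve_rem h).
Proof.
have [q Eq] := redE h; apply: (red_unique _ (rot z q)).
  by rewrite {1}Eq rmorphD rmorphM rot_curve.
apply/leq_sizeP => j le_j; rewrite coef_rot nth_default ?scaler0 //.
exact: leq_trans (size_red h) le_j.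
Qed.

Lemma rot_eq0 h : (rot z h == 0) = (h == 0).
Proof.
apply/eqP/eqP => [h0|->]; last exact: rmorph0.
by rewrite -[h]rot1 -(mulVf z_neq0) -rotM h0 rmorph0.
Qed.

Lemma nz_rot h : nonzero_on_curve (rot z h) = nonzero_on_curve h.
Proof. by rewrite /nonzero_on_curve red_rot rot_eq0. Qed.

Lemma infmap_rot c h : infmap c (rot z h) = infmap (z * c) h.
Proof.
have := rmorph_poly2_ext _ _ (infmap c \o rot z) (infmap (z * c)).
apply => [|p] /=.
  rewrite rot_y rmorphM /infmap /cst !subst2_y subst2_x comp_polyC.
  by rewrite mul_polyC scalerA.
by rewrite rot_x /infmap !subst2_x.
Qed.

(** Rotation only changes the parameter of [infmap], and a reduced polynomial has the same degree
    for every nonzero parameter. *)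
Lemma pole_order_rot h : nonzero_on_curve h -> pole_order n f (rot z h) = pole_order n f h.
Proof.
move=> hN; apply: succn_inj; rewrite -(size_infmap_red 1) ?oner_neq0 ?nz_rot //.
by rewrite red_rot infmap_rot mulr1 size_infmap_red.
Qed.

End RootOfUnity.
End PoleOrder.

(** As [n] is nonzero in [K], X^n - 1 is separable, and [n] distinct n-th roots of unity include a
    primitive one. *)
Lemma exists_prim_root (K : closedFieldType) n :
  n%:R != 0 :> K -> exists z : K, n.-primitive_root z.
Proof.
move=> n_unit; have n_gt0 : (0 < n)%N by rewrite lt0n; apply: contraNneq n_unit => ->.
have [rs Ers] := closed_field_poly_normal ('X^n - 1 : {poly K}).
have lead1 : lead_coef ('X^n - 1 : {poly K}) = 1.
  by rewrite (eqP (monicXnsubC 1 n_gt0)).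
rewrite lead1 scale1r in Ers.
have rs_uniq : uniq rs by rewrite -separable_prod_XsubC -Ers separable_Xn_sub_1.
have rs_size : (n <= size rs)%N.
  by rewrite -ltnS -(size_prod_XsubC rs id) -Ers size_XnsubC.
have /hasP[z _ z_prim] : has n.-primitive_root rs.
  apply: has_prim_root => //; apply/allP => x x_rs.
  by rewrite /root_of_unity Ers root_prod_XsubC.
by exists z.
Qed.

Lemma prod_shift (R : comNzRingType) (g : nat -> R) m :
  g m = g 0 -> \prod_(i < m) g i.+1 = \prod_(i < m) g i.
Proof.
case: m => [|m] gm; first by rewrite !big_ord0.
rewrite big_ord_recr big_ord_recl /= gm mulrC; congr (_ * _).
Qed.

(** * Divisors of functions and the norm *)

Section Divisors.
Context (K : closedFieldType) (n d : nat) (f : {poly K}).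
Hypotheses (n_gt1 : (1 < n)%N) (n_unit : n%:R != 0 :> K).
Hypotheses (deg_f : size f = d.+1) (n_d_coprime : coprime n d).
Hypothesis f_simple : forall a, f.[a] = 0 -> f^`().[a] != 0.
Local Notation F := (curve_eq n f).
Local Notation red := (curve_rem K n f).
Local Notation nz := (nonzero_on_curve K n f).
Implicit Types (h q u : {poly {poly K}}) (p : {poly K}) (a c : K).
Implicit Types (P : affine_pt n f) (D : divisor n f).

Let n_gt0 : (0 < n)%N. Proof. exact: ltnW. Qed.

Lemma orderM P m m' h h' :
  has_order P h m -> has_order P h' m' -> has_order P (h * h') (m + m').
Proof.
have [t unif] := exists_uniformizer K n f P n_gt1 n_unit f_simple.
exact: has_orderM unif _ _ _ _.
Qed.

Lemma orderX P m h k : has_order P h m -> has_order P (h ^+ k) (m * k).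
Proof.
move=> oh; elim: k => [|k IHk]; last by rewrite exprS mulnS; apply: orderM.
by rewrite muln0 expr0; apply: has_order0; rewrite rmorph1 oner_neq0.
Qed.

Lemma order_add_curve P m h q : has_order P h m -> has_order P (h + q * F) m.
Proof.
move=> [v nv]; split; first exact: vanD v (van_curve _ _ _ _ _ _).
by move=> v'; apply: nv; have := vanB _ _ _ _ _ _ _ v' (van_curve _ _ _ P _ q); rewrite addrK.
Qed.

(** Were the order k of [h] below m', the order m + k of [u * h] would be below m + m'. *)
Lemma van_cancel P m m' u h :
  has_order P u m -> vanishes P (m + m') (u * h) -> vanishes P m' h.
Proof.
move=> ou vuh; case: (Classical_Prop.classic (vanishes P m' h)) => // nv.
have [k lt_k oh] := exists_order_le _ _ _ _ _ _ nv.
have := has_order_ge _ _ _ _ _ _ _ (orderM _ _ _ _ _ ou oh) vuh.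
by rewrite leq_add2l leqNgt lt_k.
Qed.

Lemma order_x P p : p.[xcoord P] != 0 -> has_order P p%:P 0.
Proof. by move=> pP; apply: has_order0; rewrite ev_x. Qed.

Lemma order_line_unramified P :
  ycoord P != 0 -> has_order P ('X - (xcoord P)%:P)%:P 1.
Proof.
move=> y0; have := has_order_unif _ _ _ _ _ (uniformizer_x _ _ _ _ n_unit y0).
by rewrite dxE /xvar /cst -polyCB.
Qed.

(** On the curve y^n = f = f1 (x - a) with f1(a) nonzero, and y has order 1, so x - a has order
    [n]. *)
Lemma order_line_ramified P :
  ycoord P = 0 -> has_order P ('X - (xcoord P)%:P)%:P n.
Proof.
move=> y0; have fP0 : f.[xcoord P] = 0 by rewrite -on_curve y0 expr0n gtn_eqF.
have := has_order_unif _ _ _ _ _ (uniformizer_y _ _ _ _ n_gt1 f_simple y0).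
rewrite dyE y0 cst0 subr0 => /(orderX _ _ _ n)/(order_add_curve _ _ _ (-1)).
rewrite mul1n mulN1r /curve_eq opprB addrC subrK.
have /factor_theorem[f1 Ef] : root f (xcoord P) by apply/eqP.
have f1P : f1.[xcoord P] != 0.
  have := f_simple _ fP0; rewrite {1}Ef derivM derivXsubC mulr1.
  by rewrite !hornerE subrr mulr0 add0r.
have E : f%:P = f1%:P * ('X - (xcoord P)%:P)%:P by rewrite -polyCM -Ef.
move=> of_n; have nv : ~ vanishes P n.+1 ('X - (xcoord P)%:P)%:P.
  by move=> /(vanMl _ _ _ _ _ _ f1%:P); rewrite -E; case: of_n.
have [m _ om] := exists_order_le _ _ _ _ _ _ nv.
have := orderM _ _ _ _ _ (order_x _ _ f1P) om; rewrite add0n -E.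
by move/(has_order_inj _ _ _ _ _ _ _ of_n) => nm; rewrite -nm in om.
Qed.

Lemma exists_affine_pt a : exists P, xcoord P = a.
Proof.
have [b Eb] := exists_nth_root K n f.[a] n_gt0.
have onC : (a, b).2 ^+ n == f.[(a, b).1] by apply/eqP.
by exists (exist _ (a, b) onC).
Qed.

Lemma eq_affine_pt P Q : xcoord P = xcoord Q -> ycoord P = ycoord Q -> P = Q.
Proof.
rewrite /xcoord /ycoord => Ex Ey; apply: val_inj.
by rewrite [LHS]surjective_pairing [RHS]surjective_pairing Ex Ey.
Qed.

Lemma is_div_inj h D D' : is_div h D -> is_div h D' -> D = D'.
Proof.
move=> [oD iD] [oD' iD']; apply/eqP/freeg_eqP => -[P|]; last first.
  by move: iD; rewrite /mult -iD'.
have [m om Em] := oD P; have [m' om' Em'] := oD' P.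
by move: Em Em'; rewrite /mult => -> ->; rewrite (has_order_inj _ _ _ _ _ _ _ om om').
Qed.

Lemma is_div_nz h D : is_div h D -> nz h.
Proof.
move=> [oD _]; apply/eqP => /(red0P _ _ _ n_gt1)[q Eh].
have [P _] := exists_affine_pt 0; have [m [_ nv] _] := oD P.
by apply: nv; rewrite Eh; apply: van_curve.
Qed.

Lemma is_div_add_curve h q D : is_div h D -> is_div (h + q * F) D.
Proof.
move=> [oD iD]; split=> [P|]; last first.
  by rewrite iD !pole_orderE redD // red_curve // addr0.
by have [m om Em] := oD P; exists m => //; apply: order_add_curve.
Qed.

Lemma is_divM h h' D D' : is_div h D -> is_div h' D' -> is_div (h * h') (D + D').
Proof.
move=> hD hD'; have hN := is_div_nz _ _ hD; have hN' := is_div_nz _ _ hD'.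
case: hD hD' => [oD iD] [oD' iD']; split=> [P|]; last first.
  have [_ ->] := pole_orderM K n d f n_gt1 deg_f n_d_coprime h h' hN hN'.
  by rewrite /mult coeffD PoszD opprD -iD -iD'.
have [m om Em] := oD P; have [m' om' Em'] := oD' P.
by exists (m + m')%N; [apply: orderM | rewrite /mult coeffD PoszD -Em -Em'].
Qed.

Lemma is_div_cst c : c != 0 -> is_div (cst c) (0 : divisor n f).
Proof.
move=> c0; split=> [P|].
  by exists 0%N; [apply: has_order0; rewrite ev_cst | rewrite /mult coeff0].
have := pole_order_x K n d f n_gt1 deg_f n_d_coprime c%:P.
rewrite polyC_eq0 => /(_ c0)[_]; rewrite size_polyC c0 muln0 => ->.
by rewrite /mult coeff0 oppr0.
Qed.

(** The fibre over [a] is one point of multiplicity [n] if f(a) = 0, and otherwise the [n] points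
    with ordinates z^i b; either way it balances the pole of order [n]. *)
Lemma is_div_line a : exists2 D : divisor n f, is_div ('X - a%:P)%:P D & deg D = 0.
Proof.
have poleE : pole_order n f ('X - a%:P)%:P = n.
  have [_ ->] := pole_order_x K n d f n_gt1 deg_f n_d_coprime _ (negbT (polyXsubC_eq0 a)).
  by rewrite size_XsubC muln1.
have off P : xcoord P != a -> has_order P ('X - a%:P)%:P 0.
  by move=> Pa; apply: order_x; rewrite !hornerE subr_eq0.
have [b bE] := exists_nth_root K n f.[a] n_gt0.
have [b0|b0] := eqVneq b 0.
  have onC : (a, b).2 ^+ n == f.[(a, b).1] by apply/eqP.
  pose P0 : affine_pt n f := exist _ (a, b) onC.
  exists (<< (n%:Z) *g Some P0 >> - << (n%:Z) *g infty n f >>); last first.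
    by rewrite degB !degU subrr.
  split=> [P|]; last first.
    by rewrite /mult coeffB !coeffU poleE eqxx mulr1 mulr0 sub0r.
  rewrite /mult coeffB !coeffU mulr0 subr0.
  have [<-|PP0] := eqVneq P0 P.
    by exists n; [apply: (order_line_ramified P0) | rewrite eqxx mulr1].
  exists 0%N; last by rewrite (inj_eq Some_inj) (negPf PP0) mulr0.
  apply: off; apply: contra PP0 => /eqP Pa; apply/eqP/eq_affine_pt => //.
  apply/esym/eqP; have -> : ycoord P0 = 0 by rewrite -b0.
  have := expf_eq0 (ycoord P) n; rewrite n_gt0 /= => <-.
  by rewrite on_curve Pa -bE b0 expr0n gtn_eqF.
have [z z_prim] := exists_prim_root K n n_unit.
have onC i : (a, z ^+ i * b).2 ^+ n == f.[(a, z ^+ i * b).1].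
  by rewrite /= exprMn exprAC (prim_expr_order z_prim) expr1n mul1r bE.
pose R (i : nat) : affine_pt n f := exist _ (a, z ^+ i * b) (onC i).
have R_inj (i j : 'I_n) : R i = R j -> i = j.
  move=> /(congr1 (@ycoord _ _ _)); rewrite /ycoord /= => /(mulIf b0)/eqP.
  by rewrite (eq_prim_root_expr z_prim) !modn_small // => /eqP/val_inj.
have R_surj P : xcoord P = a -> exists i : 'I_n, P = R i.
  move=> Pa; have : (ycoord P / b) ^+ n = 1.
    by rewrite expr_div_n on_curve Pa bE divff // -bE expf_neq0.
  move=> /(prim_rootP z_prim)[i Ei]; exists i; apply: eq_affine_pt => //.
  by rewrite [RHS]/ycoord /= -Ei divfK.
exists (\sum_(i < n) << Some (R i) >> - << (n%:Z) *g infty n f >>); last first.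
  rewrite degB degU raddf_sum /= (eq_bigr (fun=> 1)) => [|i _]; last exact: degU.
  by rewrite sumr_const card_ord natz subrr.
have multR Q : coeff Q (\sum_(i < n) << Some (R i) >> : divisor n f)
               = \sum_(i < n) (Some (R i) == Q)%:R.
  by rewrite raddf_sum /=; apply: eq_bigr => i _; rewrite coeffU mul1r.
split=> [P|]; rewrite /mult coeffB coeffU multR; last first.
  by rewrite big1 // poleE eqxx mulr1 sub0r.
rewrite mulr0 subr0; have [/R_surj[i ->]|Pa] := eqVneq (xcoord P) a.
  exists 1%N.
    apply: (order_line_unramified (R i)); rewrite /ycoord /= mulf_neq0 //.
    by rewrite expf_neq0 // (prim_root_eq0 z_prim) -lt0n.
  rewrite (bigD1 i) //= eqxx big1 ?addr0 // => j ji.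
  by rewrite (inj_eq Some_inj); case: eqP => // /R_inj ij; rewrite ij eqxx in ji.
exists 0%N; first exact: off.
rewrite big1 // => i _; rewrite (inj_eq Some_inj); case: eqP => // RP.
by rewrite -RP eqxx in Pa.
Qed.

Lemma is_div_x p : p != 0 -> exists2 D : divisor n f, is_div p%:P D & deg D = 0.
Proof.
move=> p0; have [rs ->] := closed_field_poly_normal p.
rewrite -mul_polyC polyCM.
suff [D pD D0] : exists2 D : divisor n f, is_div (\prod_(z <- rs) ('X - z%:P))%:P D & deg D = 0.
  exists (0 + D); last by rewrite add0r.
  by apply: is_divM pD; apply: is_div_cst; rewrite lead_coef_eq0.
elim: rs => [|z rs [D pD D0]].
  by exists 0; rewrite ?deg0 // big_nil; apply: (is_div_cst 1); rewrite oner_neq0.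
have [E zE E0] := is_div_line z; exists (E + D); last by rewrite degD E0 D0.
by rewrite big_cons polyCM; apply: is_divM.
Qed.

Section Norm.
Context (z : K).
Hypothesis z_prim : n.-primitive_root z.
Local Notation rot := (rot K).

Let zXn i : (z ^+ i) ^+ n = 1.
Proof. by rewrite exprAC (prim_expr_order z_prim) expr1n. Qed.

Definition norm h := \prod_(i < n) rot (z ^+ i) h.

Lemma rot_norm h : rot z (norm h) = norm h.
Proof.
rewrite /norm rmorph_prod -(prod_shift _ (fun i => rot (z ^+ i) h)).
  by apply: eq_bigr => i _; rewrite rotM exprS.
by rewrite (prim_expr_order z_prim) expr0.
Qed.

(* An element fixed by y |-> z y involves only powers of y^n = f(x). *)
Lemma rot_fixed h : rot z h = h -> exists p q, h = p%:P + q * F.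
Proof.
(* Comparing coefficients gives (z^j - 1) h_j = 0, and z^j = 1 only when [n] divides j. *)
move=> rh; have hj j : ~~ (n %| j)%N -> h`_j = 0.
  move=> nj; have := coef_rot K z h j; rewrite rh => /eqP.
  rewrite eq_sym -subr_eq0 -{2}[h`_j]scale1r -scalerBl scaler_eq0 subr_eq0.
  by rewrite -(prim_order_dvd z_prim) (negPf nj) => /eqP.
exists (\sum_(j < size h) h`_j * f ^+ (j %/ n)).
suff [q Eq] : exists q, h - (\sum_(j < size h) h`_j * f ^+ (j %/ n))%:P = q * F.
  by exists q; rewrite -Eq addrC subrK.
rewrite -{1}[h]coefK poly_def rmorph_sum -sumrB /=.
apply: (big_ind (fun h => exists q, h = q * F)) => [|h1 h2 [q1 ->] [q2 ->]|j _].
- by exists 0; rewrite mul0r.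
- by exists (q1 + q2); rewrite mulrDl.
have [/dvdnP[k ->]|/hj->] := boolP (n %| j)%N; last first.
  by exists 0; rewrite scale0r !mul0r polyC0 subr0.
(* (y^n)^k - f^k is a multiple of y^n - f. *)
rewrite mulnK // mulnC exprM -mul_polyC polyCM polyC_exp -mulrBr subrXX.
by exists ((h`_(n * k))%:P * \sum_(i < k) ('X^n) ^+ (k.-1 - i) * f%:P ^+ i); rewrite mulrAC -mulrA.
Qed.

Lemma nz_norm h : nz h -> nz (norm h).
Proof.
move=> hN; rewrite /norm; apply: (big_ind nz) => [|h1 h2|i _].
- have [+ _] := pole_order_x K n d f n_gt1 deg_f n_d_coprime 1 (oner_neq0 _).
  by rewrite polyC1.
- exact: (nzM _ _ d).
by rewrite nz_rot.
Qed.

Lemma normE h : nz h -> exists2 p, p != 0 & exists q, norm h = p%:P + q * F.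
Proof.
move=> hN; have [p [q E]] := rot_fixed _ (rot_norm h); exists p; last by exists q.
have := nz_norm _ hN; rewrite E /nonzero_on_curve redD // red_curve // addr0.
by apply: contra => /eqP ->; rewrite red_small ?polyC0 ?eqxx // size_poly0.
Qed.

Lemma rot_affine_subproof P i : (xcoord P, z ^+ i * ycoord P).2 ^+ n
  == f.[(xcoord P, z ^+ i * ycoord P).1].
Proof. by rewrite /= exprMn zXn mul1r on_curve. Qed.

Definition rot_affine i P : affine_pt n f :=
  exist _ (xcoord P, z ^+ i * ycoord P) (rot_affine_subproof P i).

(** The rotation sends y - z^i b to z^i (y - b), so generators at the rotated point become
    generators at [P] up to a scalar. *)
Lemma van_rot i P m h :
  vanishes (rot_affine i P) m h -> vanishes P m (rot (z ^+ i) h).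
Proof.
move=> /vanP[c [q ->]]; rewrite rmorphD rmorphM rot_curve //.
apply: vanD (van_curve _ _ _ _ _ _); rewrite rmorph_sum; apply: van_sum => j _.
rewrite !rmorphM !rmorphXn -mulrA dxE dyE !rmorphB /= /xvar /yvar.
have -> : xcoord (rot_affine i P) = xcoord P by [].
have -> : ycoord (rot_affine i P) = z ^+ i * ycoord P by [].
rewrite /cst !rot_x rot_y -/(xvar K) -/(yvar K) -!/(cst _) cstM -mulrBr.
rewrite -dxE -dyE exprMn; apply: vanMl; rewrite mulrCA; apply: vanMl.
by have := van_gen K n f P j (m - j); rewrite (subnKC (ltnSE (ltn_ord j))).
Qed.

Lemma rot_affineK i j P : (i + j)%N = n -> rot_affine j (rot_affine i P) = P.
Proof.
move=> ij; apply: eq_affine_pt => //.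
by rewrite [LHS]/ycoord /= mulrA -exprD addnC ij (prim_expr_order z_prim) mul1r.
Qed.

(** [van_rot] is applied to both rotations; i + j = n writes the inverse of z^i with a natural
    exponent. *)
Lemma has_order_rot i j P m h : (i + j)%N = n ->
  has_order (rot_affine i P) h m -> has_order P (rot (z ^+ i) h) m.
Proof.
move=> ij [v nv]; split; first exact: van_rot.
have := van_rot j (rot_affine i P) m.+1 (rot (z ^+ i) h).
rewrite (rot_affineK _ _ _ ij) rotM -exprD addnC ij (prim_expr_order z_prim) rot1.
by move=> vP v'; apply/nv/vP.
Qed.

Lemma is_div_rot i h D : (i <= n)%N -> is_div h D ->
  exists2 E : divisor n f, is_div (rot (z ^+ i) h) E & deg E = deg D.
Proof.
move=> le_in hD; have hN := is_div_nz _ _ hD; case: hD => [oD iD].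
have ij := subnKC le_in; set j := (n - i)%N in ij.
have ji : (j + i = n)%N by rewrite addnC.
(* The rotated function has at [P] the order of [h] at [rot_affine i P], so the points of [D] move
   by the inverse rotation, of index j. *)
pose s (Q : pt n f) : pt n f := if Q is Some P then Some (rot_affine j P) else None.
exists (\sum_(Q <- dom D) << coeff Q D *g s Q >>); last first.
  rewrite -[in RHS](freeg_sumE D) !raddf_sum /=.
  by apply: eq_bigr => Q _; rewrite !degU.
pose s' (Q : pt n f) : pt n f := if Q is Some P then Some (rot_affine i P) else None.
have ss' Q Q' : (s Q == Q') = (Q == s' Q').
  apply/eqP/eqP => [<-|->]; [case: Q => // P | case: Q' => // P] => /=.
    by rewrite rot_affineK.
  by rewrite rot_affineK.
have multE Q : mult (\sum_(Q <- dom D) << coeff Q D *g s Q >> : divisor n f) Q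
               = mult D (s' Q).
  rewrite /mult -[in RHS](freeg_sumE D) !raddf_sum /=.
  by apply: eq_bigr => Q' _; rewrite !coeffU ss'.
split=> [P|]; rewrite multE /=; last first.
  by rewrite iD (pole_order_rot K n d f).
have [m om Em] := oD (rot_affine i P).
exact: ex_intro2 _ _ m (has_order_rot i j P m h ij om) Em.
Qed.

End Norm.

(** [h'] is the product of the other conjugates, and the norm [h * h'] is a polynomial in x on the
    curve. *)
Lemma exists_conjugate h : nz h -> exists h' p q,
  [/\ nz h', p != 0 & h * h' = p%:P + q * F].
Proof.
move=> hN; have [z z_prim] := exists_prim_root K n n_unit.
have [p p0 [q E]] := normE z z_prim h hN.
pose h' := \prod_(i < n | i != Ordinal n_gt0) rot K (z ^+ i) h.
have Eh : norm z h = h * h' by rewrite /norm (bigD1 (Ordinal n_gt0)) //= rot1.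
exists h', p, q; split; rewrite -?Eh //.
have := nz_norm z z_prim _ hN; rewrite Eh; apply: contra => /eqP/(red0P _ _ _ n_gt1)[u ->].
by rewrite mulrA red_curve.
Qed.

(** On the curve [h] divides a nonzero polynomial in x, whose order is finite. *)
Lemma exists_order P h : nz h -> exists m, has_order P h m.
Proof.
move=> hN; have [h' [p [q [_ p0 E]]]] := exists_conjugate h hN.
have [D [/(_ P)[M oM _] _] _] := is_div_x p p0.
have nv : ~ vanishes P M.+1 h.
  move/(vanMr _ _ _ _ _ _ h'); rewrite E => v.
  case: oM => _ []; rewrite -[p%:P](addrK (q * F)).
  exact: vanB v (van_curve _ _ _ _ _ _).
by have [m _ om] := exists_order_le _ _ _ _ _ _ nv; exists m.
Qed.

(** An affine zero of [h] is a zero of the [p] of [exists_conjugate], so it belongs to the finite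
    list [dom Dp]. *)
Lemma exists_is_div h : nz h -> exists D : divisor n f, is_div h D.
Proof.
move=> hN; have [h' [p [q [h'N p0 E]]]] := exists_conjugate h hN.
have [Dp [pD _] _] := is_div_x p p0.
have supp P m : has_order P h m -> Some P \notin dom Dp -> m = 0%N.
  move=> om; rewrite mem_dom negbK => /eqP Dp0.
  have [M oM EM] := pD P; have [m' om'] := exists_order P h' h'N.
  have := orderM _ _ _ _ _ om om'; rewrite E.
  move=> /(has_order_inj _ _ _ _ _ _ _ (order_add_curve _ _ _ q oM)).
  by move: EM; rewrite /mult Dp0 => -[<-] /esym/eqP; rewrite addn_eq0 => /andP[/eqP].
have [D0 D0E] : exists D : divisor n f, forall P, if Some P \in dom Dp
    then exists2 m, has_order P h m & mult D (Some P) = m%:Z else mult D (Some P) = 0.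
  elim: (dom Dp) (uniq_dom Dp) => [_|[P|] s IHs /= /andP[Ps /IHs[D DE]]].
  - by exists 0 => P; rewrite /mult coeff0.
  - have [m om] := exists_order P h hN.
    exists (D + << m%:Z *g Some P >>) => Q; rewrite /mult coeffD coeffU in_cons.
    rewrite !(inj_eq Some_inj) [P == Q]eq_sym; have := DE Q.
    have [->|QP] /= := eqVneq Q P; last by rewrite mulr0 addr0.
    by rewrite (negPf Ps) /mult => ->; exists m; rewrite // add0r mulr1.
  by exists D.
(* Only the affine coefficients of [D0] are controlled; the one at infinity is overwritten. *)
exists (D0 + << (- (pole_order n f h)%:Z - coeff (infty n f) D0) *g infty n f >>).
split=> [P|]; rewrite /mult coeffD coeffU; last by rewrite eqxx mulr1 addrC subrK.
rewrite mulr0 addr0; have := D0E P; case: ifP => // Pdom DP0.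
have [m om] := exists_order P h hN; exists m => //.
by rewrite -/(mult D0 _) DP0 (supp P m om) // Pdom.
Qed.

(** The norm of [h] has a divisor of degree n deg D, which is also the divisor of a polynomial in x,
    of degree 0. *)
Lemma is_div_deg h D : is_div h D -> deg D = 0.
Proof.
move=> hD; have hN := is_div_nz _ _ hD.
have [z z_prim] := exists_prim_root K n n_unit.
have [p p0 [q E]] := normE z z_prim h hN.
have [Dp pD Dp0] := is_div_x p p0.
have prod_div k : (k <= n)%N -> exists N : divisor n f,
    is_div (\prod_(i < k) rot K (z ^+ i) h) N /\ deg N = deg D *+ k.
  elim: k => [_|k IHk lt_k].
    exists 0; rewrite big_ord0 deg0 mulr0n; split=> //.
    by have := is_div_cst 1 (oner_neq0 _); rewrite cst1.
  have [N [NE N0]] := IHk (ltnW lt_k).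
  have [Ek kE k0] := is_div_rot z z_prim k h D (ltnW lt_k) hD.
  exists (N + Ek); rewrite big_ord_recr degD N0 k0 mulrSr; split=> //.
  exact: is_divM.
have [N [NE N0]] := prod_div n (leqnn n).
move: NE; rewrite -/(norm z h) E => /is_div_inj/(_ (is_div_add_curve _ q _ pD)) NDp.
move: N0; rewrite NDp Dp0 => /esym/eqP; rewrite mulrn_eq0 gtn_eqF //=.
by move/eqP.
Qed.

End Divisors.

(** * Integral closure of the coordinate ring *)

Section Normality.
Context (K : closedFieldType) (n d : nat) (f : {poly K}).
Hypotheses (n_gt1 : (1 < n)%N) (n_unit : n%:R != 0 :> K).
Hypotheses (deg_f : size f = d.+1) (n_d_coprime : coprime n d).
Hypothesis f_simple : forall a, f.[a] = 0 -> f^`().[a] != 0.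
Local Notation F := (curve_eq n f).
Local Notation red := (curve_rem K n f).
Local Notation nz := (nonzero_on_curve K n f).
Implicit Types (h q u : {poly {poly K}}) (p : {poly K}) (a c : K).
Implicit Types (P : affine_pt n f) (D : divisor n f).

Let n_gt0 : (0 < n)%N. Proof. exact: ltnW. Qed.

Local Notation orderM := (orderM K n f n_gt1 n_unit f_simple).
Local Notation exists_order := (exists_order K n d f n_gt1 n_unit deg_f n_d_coprime f_simple).

Lemma split_at a h : exists r,
  h = map_poly polyC (map_poly (horner_eval a) h) + r * ('X - a%:P)%:P.
Proof.
elim/poly_ind: h => [|h c [r IHh]].
  by exists 0; rewrite !rmorph0 mul0r addr0.
have /factor_theorem[c1 E1] : root (c - c.[a]%:P) a.
  by rewrite /root !hornerE subrr.
exists (r * 'X + c1%:P).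
rewrite !rmorphD !rmorphM /= !map_polyX !map_polyC /= /horner_eval.
have -> : c%:P = c.[a]%:P%:P + c1%:P * ('X - a%:P)%:P.
  by rewrite -polyCM -E1 polyCB addrC subrK.
rewrite {1}IHh !polyCB ?polyCN; move: ('X%:P - a%:P%:P) (map_poly polyC _) (c.[a]%:P%:P) => *.
by ring.
Qed.

Lemma exists_pt_at a b : b ^+ n = f.[a] -> exists P, xcoord P = a /\ ycoord P = b.
Proof.
move=> ab; have onC : (a, b).2 ^+ n == f.[(a, b).1] by apply/eqP.
by exists (exist _ (a, b) onC).
Qed.

Lemma ev_lift a b p : ev K a b (map_poly polyC p) = p.[b].
Proof. by rewrite evE /eval2 horner_map /= hornerC. Qed.

(** At such a point y is a uniformizer, so the order of p(y) is the multiplicity of the root 0 of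
    [p]. *)
Lemma order_lift P p : ycoord P = 0 -> p != 0 -> (size p <= n)%N ->
  exists2 k, (k < n)%N & has_order P (map_poly polyC p) k.
Proof.
move=> y0 p0 szp; have [k [s]] := multiplicity_XsubC p 0.
rewrite p0 polyC0 subr0 /= => s0 Ep; exists k.
  have s_neq0 : s != 0 by apply: contraNneq s0 => ->; rewrite root0.
  by apply: leq_trans szp; rewrite Ep size_mulXn // -[X in (X < _)%N]addn0 ltn_add2l size_poly_gt0.
rewrite Ep rmorphM rmorphXn /= map_polyX -[k]add0n; apply: orderM.
  by apply: has_order0; rewrite ev_lift y0.
have := has_order_unif _ _ _ _ _ (uniformizer_y _ _ _ _ n_gt1 f_simple y0).
rewrite dyE y0 cst0 subr0 => /(orderX K n f n_gt1 n_unit f_simple _ _ _ k).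
by rewrite mul1n.
Qed.

(** The reduced [h] restricted to x = a is a polynomial [s] in y of degree below [n]. It is zero:
    over a root of [f] its order would be at least [n], and elsewhere it has [n] distinct roots. *)
Lemma divide_line a h :
  (forall P m, has_order P ('X - a%:P)%:P m -> vanishes P m h) ->
  exists g q, h = g * ('X - a%:P)%:P + q * F.
Proof.
move=> vh; have [q Eq] := redE _ _ f n_gt1 h.
have [r Er] := split_at a (red h); set s := map_poly _ (red h) in Er.
have sz_s : (size s <= n)%N := leq_trans (size_poly _ _) (size_red _ _ _ n_gt1 h).
suff s0 : s = 0 by exists r, q; rewrite {1}Eq Er s0 rmorph0 add0r addrC.
have vs P m : has_order P ('X - a%:P)%:P m -> vanishes P m (map_poly polyC s).
  move=> oP; have -> : map_poly polyC s = h - q * F - r * ('X - a%:P)%:P.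
    by rewrite {1}Eq Er [q * F + _]addrC !addrK.
  apply: vanB; last by apply: vanMl; case: oP.
  by apply: vanB (van_curve _ _ _ _ _ _); apply: vh.
have [b bE] := exists_nth_root K n f.[a] n_gt0.
have [b0|b0] := eqVneq b 0.
  have [P [Pa Pb]] := exists_pt_at a b bE; rewrite b0 in Pb.
  apply/eqP/negPn/negP => s_neq0.
  have [k lt_kn ok] := order_lift P s Pb s_neq0 sz_s.
  have := order_line_ramified K n f n_gt1 n_unit f_simple P Pb; rewrite Pa.
  by move/vs/(has_order_ge _ _ _ _ _ _ _ ok); rewrite leqNgt lt_kn.
have [z z_prim] := exists_prim_root K n n_unit.
apply: (@roots_geq_poly_eq0 _ s [seq z ^+ (i : 'I_n) * b | i <- enum 'I_n]).
- apply/allP => _ /mapP[i _ ->]; have [|P [Pa Pb]] := exists_pt_at a (z ^+ i * b).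
    by rewrite exprMn exprAC (prim_expr_order z_prim) expr1n mul1r.
  have Pb0 : ycoord P != 0.
    by rewrite Pb mulf_neq0 ?expf_neq0 // (prim_root_eq0 z_prim) -lt0n.
  have := order_line_unramified K n f n_unit P Pb0; rewrite Pa.
  by move/vs/van1P; rewrite ev_lift Pb => /eqP.
- rewrite map_inj_uniq ?enum_uniq // => i j /(mulIf b0)/eqP.
  by rewrite (eq_prim_root_expr z_prim) !modn_small // => /eqP/val_inj.
by rewrite size_map size_enum_ord.
Qed.

(** One linear factor at a time: [divide_line] removes it, and [van_cancel] passes the vanishing
    condition to the quotient. *)
Lemma divide_x p h : p != 0 ->
  (forall P m, has_order P p%:P m -> vanishes P m h) ->
  exists g q, h = g * p%:P + q * F.
Proof.
have [rs ->] := closed_field_poly_normal p; move: (lead_coef p) => c.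
rewrite scaler_eq0 negb_or => /andP[c0 _]; elim: rs h => [|a rs IHrs] h vh.
  exists (h * cst c^-1), 0; rewrite big_nil mul0r addr0 alg_polyC -/(cst c).
  by rewrite -mulrA -cstM mulVf // cst1 mulr1.
set p' := c *: _ in IHrs.
have p'0 : p' != 0.
  by rewrite scaler_eq0 negb_or c0 monic_neq0 // monic_prod_XsubC.
have E : (c *: \prod_(z <- a :: rs) ('X - z%:P))%:P = ('X - a%:P)%:P * p'%:P.
  by rewrite big_cons scalerAr polyCM.
rewrite E in vh *.
have [p'N _] := pole_order_x K n d f n_gt1 deg_f n_d_coprime _ p'0.
have [lN _] := pole_order_x K n d f n_gt1 deg_f n_d_coprime _ (negbT (polyXsubC_eq0 a)).
have [|g1 [q1 Eh]] := divide_line a h.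
  move=> P m oP; have [m' oP'] := exists_order P _ p'N.
  exact: van_le (leq_addr m' m) (vh _ _ (orderM _ _ _ _ _ oP oP')).
have [|g [q Eg]] := IHrs g1; last first.
  exists g, (q * ('X - a%:P)%:P + q1); rewrite {1}Eh {1}Eg.
  by move: (_%:P) (p'%:P) F => *; ring.
move=> P m' oP'; have [m oP] := exists_order P _ lN.
apply: (van_cancel K n f n_gt1 n_unit f_simple _ _ _ _ _ oP).
have := vanB _ _ _ _ _ _ _ (vh _ _ (orderM _ _ _ _ _ oP oP')) (van_curve _ _ _ P _ q1).
by rewrite {1}Eh addrK mulrC.
Qed.

(* The coordinate ring is integrally closed: regularity at every affine point
   implies being a polynomial. *)
Lemma divide u h : nz u ->
  (forall P m, has_order P u m -> vanishes P m h) ->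
  exists g q, h = g * u + q * F.
Proof.
move=> uN vh; have [u' [p [q [u'N p0 E]]]] :=
  exists_conjugate K n d f n_gt1 n_unit deg_f n_d_coprime u uN.
have [|g [q1 E1]] := divide_x p (h * u') p0.
  move=> P m om; have [m1 om1] := exists_order P u uN.
  have [m2 om2] := exists_order P u' u'N.
  have := order_add_curve _ _ _ _ _ _ q om; rewrite -E.
  move/(has_order_inj _ _ _ _ _ _ _ (orderM _ _ _ _ _ om1 om2)) <-.
  by apply: van_prod; [apply: vh | case: om2].
(* Multiplied by [u'], the difference [h - g * u] vanishes on the curve; since [u'] does not, [nzM]
   forces the difference to vanish. *)
have [hgu|hguN] := eqVneq (red (h - g * u)) 0.
  have [q2 E2] := (red0P _ _ _ n_gt1 _).1 hgu.
  by exists g, q2; rewrite -E2 addrC subrK.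
have := nzM K n d f n_gt1 deg_f n_d_coprime _ _ hguN u'N.
have -> : (h - g * u) * u' = (q1 - g * q) * F.
  rewrite mulrBl E1 -mulrA E.
  by move: (p%:P) F => *; ring.
by rewrite /nonzero_on_curve red_curve // eqxx.
Qed.

End Normality.

(** * The genus and the monomials *)

Section RiemannRoch.
Context (K : closedFieldType) (n d : nat) (f : {poly K}).
Hypotheses (n_gt1 : (1 < n)%N) (n_unit : n%:R != 0 :> K).
Hypotheses (deg_f : size f = d.+1) (n_d_coprime : coprime n d).
Hypothesis f_simple : forall a, f.[a] = 0 -> f^`().[a] != 0.
Local Notation F := (curve_eq n f).
Local Notation red := (curve_rem K n f).
Local Notation nz := (nonzero_on_curve K n f).
Implicit Types (h q u : {poly {poly K}}) (p : {poly K}) (a c : K).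
Implicit Types (P : affine_pt n f) (D : divisor n f).

Let n_gt0 : (0 < n)%N. Proof. exact: ltnW. Qed.

(** As [n] is positive, n i <= N forces i <= N, so the finite range of exponents misses nothing. *)
Definition monoms N : seq (nat * nat) :=
  [seq m <- [seq (i, j) | i <- iota 0 N.+1, j <- iota 0 n]
     | (monom_pole n f m <= N)%N].

Lemma mem_monoms N m :
  (m \in monoms N) = (m.2 < n)%N && (monom_pole n f m <= N)%N.
Proof.
rewrite mem_filter; have [leN|ltN] := leqP (monom_pole n f m) N; last by rewrite andbF.
rewrite andbT; apply/allpairsPdep/idP => [[i [j [_ + ->]]]|ltj].
  by rewrite mem_iota add0n.
exists m.1, m.2; rewrite !mem_iota !add0n /= ltj ltnS -surjective_pairing; split=> //.
by move: leN; rewrite /monom_pole; move: (n) n_gt0 => [//|n'] _; nia.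
Qed.

Lemma monoms_uniq N : uniq (monoms N).
Proof.
apply/filter_uniq/allpairs_uniq; rewrite ?iota_uniq //.
by move=> [? ?] [? ?].
Qed.

Lemma coef_cstM c h i j : ((cst c * h)`_j)`_i = c * (h`_j)`_i.
Proof. by rewrite /cst !coefCM. Qed.

(** The coefficients of the [g i] are supported on [monoms N], so they form a matrix with more rows
    than columns. *)
Lemma linear_dependency r N (g : 'I_r -> {poly {poly K}}) :
  (forall i, (size (g i) <= n)%N) -> (forall i, wtle K n d N (g i)) ->
  (size (monoms N) < r)%N ->
  exists2 v : 'I_r -> K, \sum_i cst (v i) * g i = 0 & exists i, v i != 0.
Proof.
move=> szg wg lt_r; set ms := monoms N in lt_r *.
pose A := \matrix_(i < r, k < size ms)
  ((g i)`_(nth (0%N, 0%N) ms k).2)`_(nth (0%N, 0%N) ms k).1.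
have /rowV0Pn[v /sub_kermxP vA v0] : kermx A != 0.
  rewrite kermx_eq0 /row_free neq_ltn; apply/orP; left.
  exact: leq_ltn_trans (rank_leq_col _) lt_r.
exists (fun i => v 0 i); last first.
  apply/existsP; move: v0; apply: contraR; rewrite negb_exists => /forallP vi0.
  by apply/eqP/rowP => i; rewrite mxE; have := vi0 i; rewrite negbK => /eqP.
apply/polyP => j; apply/polyP => i; rewrite !coef0 !coef_sum.
have [m_ms|m_ms] := boolP ((i, j) \in ms); last first.
  rewrite big1 // => k _; rewrite coef_cstM; apply/eqP; rewrite mulf_eq0.
  apply/orP; right; apply: contraR m_ms => gk.
  rewrite mem_monoms /monom_pole deg_f /= (wg k i j gk) andbT ltnNge.
  apply: contra gk => le_nj; rewrite [(g k)`_j]nth_default ?coef0 //.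
  exact: leq_trans (szg k) le_nj.
have idx : (index (i, j) ms < size ms)%N by rewrite index_mem.
have := congr1 (fun B : 'rV_(size ms) => B 0 (Ordinal idx)) vA.
rewrite !mxE => E; rewrite -[RHS]E; apply: eq_bigr => k _.
by rewrite coef_cstM mxE /= nth_index.
Qed.

(** Each h_i / u is regular at the affine points, hence by [divide] equal to a reduced polynomial of
    weight at most [N]. A relation between these polynomials, multiplied by [u], is one between the
    [h i]. *)
Lemma RR_dim_ge_bound N r :
  RR_dim_ge (divpt (infty n f) *+ N) r -> (r <= size (monoms N))%N.
Proof.
move=> [u [Du [h [uDu free_h eff_h]]]]; rewrite leqNgt; apply/negP => lt_r.
have uN := is_div_nz _ _ _ n_gt1 _ _ uDu.
have /fin_all_exists[g gE] (i : 'I_r) : exists g : {poly {poly K}},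
    [/\ (size g <= n)%N, wtle K n d N g & exists q, h i = g * u + q * F].
  have [Dh hDh eff] := eff_h i; have hN := is_div_nz _ _ _ n_gt1 _ _ hDh.
  have [|g [q E]] := divide K n d f n_gt1 n_unit deg_f n_d_coprime f_simple u (h i) uN.
    move=> P m om; have [/(_ P)[m1 om1 E1] _] := hDh.
    have [/(_ P)[m2 om2 E2] _] := uDu.
    have := eff (Some P); rewrite /mult coeffD coeffB -!/(mult _ _) E1 E2.
    rewrite /mult coeffMn coeffU mulr0 mul0rn addr0 subr_ge0 lez_nat.
    rewrite (has_order_inj _ _ _ _ _ _ _ om om2) => le_m.
    by apply: van_le le_m _; case: om1.
  have [q' E'] := redE K n f n_gt1 g.
  exists (red g); split; first exact: size_red.
    have gN : nz g.
      apply/eqP => g0; case/eqP: hN; apply/(red0P _ _ _ n_gt1).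
      by exists (q' * u + q); rewrite E E' g0 addr0 mulrDl mulrAC.
    have poleE : pole_order n f (h i) = (pole_order n f g + pole_order n f u)%N.
      have [_ <-] := pole_orderM K n d f n_gt1 deg_f n_d_coprime _ _ gN uN.
      by rewrite E !pole_orderE redD // red_curve // addr0.
    apply: wtle_leq (wtle_max_pole _ _ _ _ deg_f _); rewrite -pole_orderE.
    have [_ iDh] := hDh; have [_ iDu] := uDu; have := eff (infty n f).
    rewrite /mult coeffD coeffB -!/(mult _ _) iDh iDu poleE.
    by rewrite /mult coeffMn coeffU eqxx; lia.
  exists (q' * u + q); rewrite E {1}E' mulrDl mulrDl addrAC.
  by rewrite [_ + red g * u]addrC mulrAC addrA.
have szg i : (size (g i) <= n)%N by have [] := gE i.
have wg i : wtle K n d N (g i) by have [] := gE i.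
have /fin_all_exists[q qE] (i : 'I_r) : exists q, h i = g i * u + q * F by have [] := gE i.
have [v gv [i]] := linear_dependency r N g szg wg lt_r.
rewrite (free_h v (\sum_i cst (v i) * q i)) ?eqxx //.
under eq_bigr do rewrite qE mulrDr !mulrA.
by rewrite big_split /= -!mulr_suml gv mul0r add0r.
Qed.

Lemma RR_dim_ge0 D : RR_dim_ge D 0.
Proof.
exists 1, 0, (fun _ => 1); split=> [||[]//].
  have := is_div_cst K n d f n_gt1 deg_f n_d_coprime 1 (oner_neq0 _).
  by rewrite cst1.
by move=> c q _ [].
Qed.

(** Dimension 0 is always reached, so descending from an upper bound meets the exact dimension. *)
Lemma exists_RR_dim D l : ~ RR_dim_ge D l.+1 -> exists2 l', (l' <= l)%N & RR_dim D l'.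
Proof.
elim: l => [|l IHl] nge; first by exists 0%N; rewrite // /RR_dim; split=> //; apply: RR_dim_ge0.
have [ge|/IHl[l' le_l' Dl']] := Classical_Prop.classic (RR_dim_ge D l.+1).
  by exists l.+1.
by exists l' => //; apply: leqW.
Qed.

(** The genus inequality for the divisor N oo, with its dimension bounded by the number of
    monomials. *)
Lemma genus_monoms g N : is_genus n f g -> (N.+1 <= g + size (monoms N))%N.
Proof.
move=> [genus_le _]; have [|l le_l Dl] := exists_RR_dim (divpt (infty n f) *+ N) (size (monoms N)).
  by move/RR_dim_ge_bound; rewrite ltnn.
have := genus_le _ _ Dl; rewrite degMn degU -mulr_natr mul1r natz.
lia.
Qed.

(** At least 2g + 1 monomials have pole order at most 3g. If that of [phi s] were larger, all of
    them would be among the other 2g values of [phi]. *)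
Lemma first_monoms_pole g (phi : 'I_(2 * g).+1 -> nat * nat) s :
  is_genus n f g -> first_monoms n f phi -> (monom_pole n f (phi s) <= 3 * g)%N.
Proof.
move=> gen [phi_n phi_incr phi_first]; rewrite leqNgt; apply/negP => lt_s.
have sub : {subset monoms (3 * g) <= [seq phi i | i <- rem s (enum 'I_(2 * g).+1)]}.
  move=> m; rewrite mem_monoms => /andP[m_n le_m].
  have [[s' Es']|/(_ s) lt_m] := phi_first m m_n; last first.
    by have := ltn_trans lt_s lt_m; rewrite ltnNge le_m.
  apply/mapP; exists s' => //; rewrite (mem_rem_uniq _ (enum_uniq _)) !inE mem_enum andbT.
  by apply: contraTneq le_m => ss; rewrite -Es' ss -ltnNge.
have := uniq_leq_size (monoms_uniq _) sub.
rewrite size_map size_rem ?mem_enum // size_enum_ord /=.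
have := genus_monoms g (3 * g) gen; lia.
Qed.

End RiemannRoch.

(** * Effective divisors and linear equivalence *)

Section EffectiveDivisors.
Context (T : choiceType).

(** Induction on the degree, removing one point of the support at a time. *)
Lemma effective_sum (m : nat) (D : {freeg T / int}) :
  (forall z, 0 <= coeff z D) -> deg D = m%:Z ->
  exists Q : 'I_m -> T, D = \sum_i << Q i >>.
Proof.
elim: m D => [|m IHm] D D_ge0 degD.
  have Q0 (i : 'I_0) : T by case: i.
  by exists Q0; rewrite big_ord0; apply/fgpos_eq0P => //; apply/fgposP.
have /hasP[p p_dom _] : has predT (dom D).
  rewrite has_predT lt0n size_eq0 dom_eq0.
  by apply: contraTneq isT => D0; move: degD; rewrite D0 deg0.
have [|//|Q EQ] := IHm (D - << p >>).
- move=> z; rewrite coeffB coeffU mul1r; have := D_ge0 z.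
  have [<-|_] := eqVneq p z; last by rewrite subr0.
  by move: p_dom; rewrite mem_dom; lia.
- by rewrite degB degU degD; lia.
exists (fun i => if unlift ord0 i is Some j then Q j else p).
rewrite big_ord_recl unlift_none -[LHS](subrK << p >>) EQ addrC; congr (_ + _).
by apply: eq_bigr => i _; rewrite liftK.
Qed.

End EffectiveDivisors.

Section LinearEquivalence.
Context (K : closedFieldType) (n d : nat) (f : {poly K}).
Hypotheses (n_gt1 : (1 < n)%N) (n_unit : n%:R != 0 :> K).
Hypotheses (deg_f : size f = d.+1) (n_d_coprime : coprime n d).
Hypothesis f_simple : forall a, f.[a] = 0 -> f^`().[a] != 0.
Implicit Types D E : divisor n f.

Lemma principal_div h D : is_div h D -> principal D.
Proof.
move=> hD; exists h, 1, D, 0; rewrite subr0; split=> //.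
have := is_div_cst K n d f n_gt1 deg_f n_d_coprime 1 (oner_neq0 _).
by rewrite cst1.
Qed.

Lemma principalD D E : principal D -> principal E -> principal (D + E).
Proof.
move=> [h [u [Dh [Du [hD uD ->]]]]] [h' [u' [Dh' [Du' [hD' uD' ->]]]]].
exists (h * h'), (u * u'), (Dh + Dh'), (Du + Du').
have divM := is_divM K n d f n_gt1 n_unit deg_f n_d_coprime f_simple.
by split; [exact: divM _ _ _ _ hD hD' | exact: divM _ _ _ _ uD uD' | rewrite opprD addrACA].
Qed.

Lemma principalN D : principal D -> principal (- D).
Proof.
by move=> [h [u [Dh [Du [hD uD ->]]]]]; exists u, h, Du, Dh; rewrite opprB.
Qed.

End LinearEquivalence.

Lemma simple_roots (K : closedFieldType) (f : {poly K}) : f != 0 ->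
  distinct_roots f -> forall a, f.[a] = 0 -> f^`().[a] != 0.
Proof.
move=> f0 [rs rs_uniq Ef] a fa.
have a_rs : a \in rs.
  have : root f a by apply/eqP.
  by rewrite Ef rootZ ?lead_coef_eq0 // root_prod_XsubC.
set g := lead_coef f *: \prod_(r <- rem a rs) ('X - r%:P).
have -> : f = ('X - a%:P) * g.
  by rewrite Ef (perm_big _ (perm_to_rem a_rs)) big_cons -scalerAr.
rewrite derivM derivXsubC !hornerE subrr mul0r addr0.
have : ~~ root g a.
  by rewrite rootZ ?lead_coef_eq0 // root_prod_XsubC mem_rem_uniqF.
by rewrite /root /g !hornerE.
Qed.

(** * The interpolation determinant *)

Section Interpolation.
Context (K : closedFieldType) (n d : nat) (f : {poly K}).
Hypotheses (n_gt1 : (1 < n)%N) (deg_f : size f = d.+1).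
Context (N : nat) (e : 'I_N.+1 -> nat * nat) (P : 'I_N -> affine_pt n f).
Local Notation h := (\det (interp_mx e P)).

(** Evaluation at [P i] makes the first row equal to the row of [P i]. *)
Lemma ev_interp_mx i : ev K (xcoord (P i)) (ycoord (P i)) h = 0.
Proof.
rewrite -det_map_mx; apply: (@determinant_alternate _ _ _ ord0 (fintype.lift ord0 i)).
  by rewrite neq_lift.
by move=> s; rewrite !mxE unlift_none liftK ev_cst evE.
Qed.

(** Expansion along the first row; all other rows, hence the cofactors, are constant. *)
Lemma interp_mx_combination : exists c : 'I_N.+1 -> K, h = \sum_s cst (c s) * monom K (e s).
Proof.
pose B := \matrix_(r < N, s < N.+1)
  eval2 (monom K (e s)) (xcoord (P r)) (ycoord (P r)).
exists (fun s : 'I_N.+1 => (-1) ^+ (0 + s) * \det (col' s B)).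
rewrite (expand_det_row _ ord0); apply: eq_bigr => s _.
rewrite !mxE unlift_none mulrC; congr (_ * _); rewrite /cofactor.
have -> : row' ord0 (col' s (interp_mx e P)) = map_mx (polyC \o polyC) (col' s B).
  by apply/matrixP => i j; rewrite !mxE liftK.
by rewrite det_map_mx /= cstM /cst !rmorphXn /= !rmorphN1.
Qed.

Lemma size_interp_mx : (forall s, ((e s).2 < n)%N) -> (size h <= n)%N.
Proof.
move=> e_n; have [c ->] := interp_mx_combination.
apply: (leq_trans (size_sum _ _ _)); apply/bigmax_leqP => s _.
rewrite /monom /xvar /yvar /cst mulrA -polyC_exp -polyCM mul_polyC.
by rewrite (leq_trans (size_scale_leq _ _)) // size_polyXn.
Qed.

Lemma wtle_interp_mx M :
  (forall s, (monom_pole n f (e s) <= M)%N) -> wtle K n d M h.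
Proof.
move=> e_M; have [c ->] := interp_mx_combination.
apply: (big_ind (wtle K n d M)) => [i j||s _].
- by rewrite !coef0 eqxx.
- exact: wtleD.
rewrite /monom /xvar /yvar /cst mulrA -polyC_exp -polyCM mul_polyC.
apply: wtle_leq (wtle_monom _ _ _ _ _); apply: leq_trans (e_M s).
rewrite /monom_pole deg_f /= leq_add2r leq_mul2l; apply/orP; right.
rewrite mul_polyC; have := size_scale_leq (c s) ('X^((e s).1) : {poly K}).
by rewrite size_polyXn; case: size.
Qed.

End Interpolation.

(** * Rationality of divisor classes over the base field *)

Section Descent.
Context (k : fieldType) (K : closedFieldType) (iota : {rmorphism k -> K}).
Context (n d : nat) (f : {poly k}).
Hypotheses (n_gt1 : (1 < n)%N) (n_unit : n%:R != 0 :> K).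
Hypotheses (deg_f : size (fK iota f) = d.+1) (n_d_coprime : coprime n d).
Hypothesis f_simple :
  forall a, (fK iota f).[a] = 0 -> (fK iota f)^`().[a] != 0.
Implicit Types D E : divisor n (fK iota f).

(** Local equations multiply on the intersection of the two neighbourhoods, where [w * w'] is
    nonzero. *)
Lemma rational_divD D E : rational_div D -> rational_div E -> rational_div (D + E).
Proof.
move=> rD rE P; have [w [u1 [u2 [D1 [D2 [wP u1D u2D DE]]]]]] := rD P.
have [w' [v1 [v2 [E1 [E2 [wP' v1E v2E EE]]]]]] := rE P.
have poly2KM (g g' : {poly {poly k}}) : poly2K iota (g * g') = poly2K iota g * poly2K iota g'.
  exact: rmorphM.
have divM := is_divM K n d _ n_gt1 n_unit deg_f n_d_coprime f_simple.
exists (w * w'), (u1 * v1), (u2 * v2), (D1 + E1), (D2 + E2); split.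
- by rewrite poly2KM -evE rmorphM !evE mulf_neq0.
- by rewrite poly2KM; apply: (divM _ _ _ _ u1D v1E).
- by rewrite poly2KM; apply: (divM _ _ _ _ u2D v2E).
move=> Q; rewrite poly2KM -evE rmorphM !evE mulf_eq0 negb_or => /andP[wQ w'Q].
rewrite /mult coeffD -!/(mult _ _) DE // EE // /mult !coeffB !coeffD.
by rewrite opprD addrACA.
Qed.

Lemma in_JacD D E : in_Jac D -> in_Jac E -> in_Jac (D + E).
Proof.
move=> [D0 [D' rD' DD']] [E0 [E' rE' EE']].
split; first by rewrite degD D0 E0.
exists (D' + E'); first exact: rational_divD.
rewrite /lin_equiv opprD addrACA.
exact: (principalD K n d _ n_gt1 n_unit deg_f n_d_coprime f_simple).
Qed.

Lemma in_Jac_equiv D E : deg E = 0 -> lin_equiv D E -> in_Jac D -> in_Jac E.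
Proof.
move=> E0 DE [D0 [D' rD' DD']]; split=> //; exists D' => //.
rewrite /lin_equiv -(subrK D E) -addrA.
apply: (principalD K n d _ n_gt1 n_unit deg_f n_d_coprime f_simple) => //.
by rewrite -opprB; apply: principalN.
Qed.

End Descent.

Theorem theorem5p9
  (k : fieldType) (K : closedFieldType) (iota : {rmorphism k -> K})
  (K_algebraic : forall z : K, algebraicOver iota z)
  (n d g : nat) (f : {poly k})
  (n_gt1 : (1 < n)%N) (n_unit : n%:R != 0 :> k)
  (deg_f : size f = d.+1) (n_lt_d : (n < d)%N) (n_d_coprime : coprime n d)
  (f_roots : distinct_roots (fK iota f))
  (genus_g : is_genus n (fK iota f) g) (g_ge2 : (2 <= g)%N)
  (P : 'I_(2 * g) -> affine_pt n (fK iota f)) (P_distinct : injective P)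
  (D1 D2 : divisor n (fK iota f))
  (D1E : D1 = \sum_(i < 2 * g | (i < g)%N) divpt (Some (P i))
              - divpt (infty n (fK iota f)) *+ g)
  (D2E : D2 = \sum_(i < 2 * g | (g <= i)%N) divpt (Some (P i))
              - divpt (infty n (fK iota f)) *+ g)
  (D1_reduced : reduced_form D1 g) (D2_reduced : reduced_form D2 g)
  (D1_Jac : in_Jac D1) (D2_Jac : in_Jac D2)
  (phi : 'I_(2 * g).+1 -> nat * nat)
  (phi_first : first_monoms n (fK iota f) phi)
  (Y_curve : \det (interp_mx phi P) != 0) :
  exists Q : 'I_g -> pt n (fK iota f),
    is_intersection (3 * g) (\det (interp_mx phi P))
      (\sum_(i < 2 * g) divpt (Some (P i)) + \sum_(i < g) divpt (Q i))
    /\ eq_Jac (D1 + D2)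
         (- (\sum_(i < g) divpt (Q i) - divpt (infty n (fK iota f)) *+ g)).
Proof.
have nK_unit : n%:R != 0 :> K by rewrite -(rmorph_nat iota) fmorph_eq0.
have degK : size (fK iota f) = d.+1 by rewrite size_map_poly.
have fK0 : fK iota f != 0 by rewrite -size_poly_eq0 degK.
have simple := simple_roots _ _ fK0 f_roots.
set h := \det _ in Y_curve *; pose o := infty n (fK iota f).
have phi_n : forall s, ((phi s).2 < n)%N by case: phi_first.
have sz_h : (size h <= n)%N by apply: size_interp_mx.
(* All monomials have y-degree below [n], so the determinant is its own remainder, and [Y_curve]
   makes it nonzero on the curve. *)
have red_h : curve_rem K n (fK iota f) h = h by apply: red_small.
have h_nz : nonzero_on_curve K n (fK iota f) h by rewrite /nonzero_on_curve red_h.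
have [D hD] := exists_is_div K n d _ n_gt1 nK_unit degK n_d_coprime simple h h_nz.
have degD0 := is_div_deg K n d _ n_gt1 nK_unit degK n_d_coprime simple h D hD.
have pole_h : (pole_order n (fK iota f) h <= 3 * g)%N.
  rewrite pole_orderE red_h; apply: (max_pole_le _ _ _ _ degK).
  apply: (wtle_interp_mx _ _ _ _ degK) => s.
  exact: (first_monoms_pole K n d _ n_gt1 nK_unit degK n_d_coprime simple).
pose SP : divisor n (fK iota f) := \sum_(i < 2 * g) divpt (Some (P i)).
have coeffSP z : coeff z SP = \sum_i (Some (P i) == z)%:R.
  by rewrite raddf_sum; apply: eq_bigr => i _; rewrite /= /divpt coeffU mul1r.
(* The residual intersection: an effective divisor of degree 3g - 2g = g. Some [Q i] may be the
   point at infinity. *)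
have [||Q EQ] := effective_sum _ g (D - SP + << o >> *+ (3 * g)).
- move=> [R|]; rewrite coeffD coeffB coeffMn coeffU coeffSP.
    have [/(_ R)[m om Em] _] := hD; move: Em; rewrite /mult => ->.
    rewrite mulr0 mul0rn addr0 subr_ge0.
    (* As the [P i] are distinct, each counts once in [SP], so order at least 1 of the determinant
       suffices. *)
    have [/existsP[i /eqP Pi]|] := boolP [exists i, P i == R]; last first.
      rewrite negb_exists => /forallP PR; rewrite big1 // => i _.
      by rewrite (inj_eq Some_inj) (negPf (PR i)).
    rewrite (bigD1 i) //= Pi eqxx big1 ?addr0 => [|j ji]; last first.
      by rewrite (inj_eq Some_inj) -Pi (inj_eq P_distinct) (negPf ji).
    rewrite (_ : 1%:R = 1%:Z) // lez_nat; apply: (has_order_ge _ _ _ _ _ _ _ om).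
    by apply/van1P; rewrite -Pi ev_interp_mx.
  rewrite big1 // subr0 eqxx mul1r -mulr_natr.
  have [_] := hD; rewrite /mult => ->; lia.
- rewrite degD degB degMn degU degD0 raddf_sum (eq_bigr (fun=> 1)) => [|i _]; last exact: degU.
  by rewrite sumr_const card_ord; lia.
have DE : D = SP + \sum_(i < g) divpt (Q i) - divpt o *+ (3 * g).
  have <- : D - SP + divpt o *+ (3 * g) = \sum_(i < g) divpt (Q i) by [].
  by rewrite addrA addrK addrC subrK.
exists Q; split; first by rewrite /is_intersection -DE.
have equiv : lin_equiv (D1 + D2) (- (\sum_(i < g) divpt (Q i) - divpt o *+ g)).
  (* The three divisors, each carrying its own - g oo, add up to the divisor of the determinant. *)
  rewrite /lin_equiv opprK; have -> : D1 + D2 + (\sum_(i < g) divpt (Q i) - divpt o *+ g) = D.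
    have SPE : SP = \sum_(i < 2 * g | (i < g)%N) divpt (Some (P i))
                    + \sum_(i < 2 * g | (g <= i)%N) divpt (Some (P i)).
      rewrite /SP (bigID (fun i : 'I_(2 * g) => (i < g)%N)); congr (_ + _).
      by apply: eq_bigl => i; rewrite -leqNgt.
    have o3 : divpt o *+ (3 * g) = divpt o *+ g + divpt o *+ g + divpt o *+ g.
      by rewrite -!mulrnDr; congr (_ *+ _); lia.
    have abel (a b c x : divisor n (fK iota f)) :
        a - x + (b - x) + (c - x) = a + b + c - (x + x + x).
      by rewrite [a - x + _]addrACA (addrACA (a + b)) !opprD.
    by rewrite DE o3 SPE D1E D2E abel.
  exact: (principal_div K n d _ n_gt1 degK n_d_coprime _ _ hD).
have D12 := in_JacD _ _ _ _ _ _ n_gt1 nK_unit degK n_d_coprime simple _ _ D1_Jac D2_Jac.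
split=> //.
apply: (in_Jac_equiv _ _ _ _ _ _ n_gt1 nK_unit degK n_d_coprime simple _ _ _ equiv D12).
rewrite degN degB degMn degU raddf_sum (eq_bigr (fun=> 1)) => [|i _]; last exact: degU.
by rewrite sumr_const card_ord subrr oppr0.
Qed.
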